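(* Let $k_{\mathscr{X}},k_{\mathscr{Y}},k_{\mathscr{Z}}$ be measurable positive definite kernels on $\mathscr{X},\mathscr{Y},\mathscr{Z}$, and let $X,Y,Z$ be random elements of $\mathscr{X},\mathscr{Y},\mathscr{Z}$ with joint distribution $P_{XYZ}$ and marginals $P_X\in\mathcal{M}^2_{k_{\mathscr{X}}}(\mathscr{X})$, $P_Y\in\mathcal{M}^2_{k_{\mathscr{Y}}}(\mathscr{Y})$, $P_Z\in\mathcal{M}^1_{k_{\mathscr{Z}}}(\mathscr{Z})$. Denote $\ddot{X}=(X,Z)$ and $v_z=P_{XY|Z=z}-P_{X|Z=z}P_{Y|Z=z}$. Then $$\|\Sigma_{Y\ddot{X}|Z}\|_{HS}^2=\int\int k_{\mathscr{Z}}(z,z')\left\langle\dot{\Sigma}_{YX|Z=z},\dot{\Sigma}_{YX|Z=z'}\right\rangle_{HS}dP_Z(z)\,dP_Z(z')=\int\int k_{\mathscr{Z}}(z,z')\,h(z,z')\,dP_Z(z)\,dP_Z(z'),$$ where $$h(z,z')=\int\int k_{\mathscr{X}}(x,x')\,k_{\mathscr{Y}}(y,y')\,dv_z(x,y)\,dv_{z'}(x',y').$$ Suppose moreover that $k_{\mathscr{X}}$ and $k_{\mathscr{Y}}$ are distance-induced, i.e. for semimetrics $\rho_{\mathscr{X}}$ on $\mathscr{X}$ and $\rho_{\mathscr{Y}}$ on $\mathscr{Y}$, $$k_{\mathscr{X}}(x,x')=\rho_{\mathscr{X}}(x,\theta)+\rho_{\mathscr{X}}(x',\theta)-\rho_{\mathscr{X}}(x,x'),\qquad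 k_{\mathscr{Y}}(y,y')=\rho_{\mathscr{Y}}(y,\theta')+\rho_{\mathscr{Y}}(y',\theta')-\rho_{\mathscr{Y}}(y,y')$$ for some $\theta\in\mathscr{X}$ and $\theta'\in\mathscr{Y}$. Then $$h(z,z')=\int\int\rho_{\mathscr{X}}(x,x')\,\rho_{\mathscr{Y}}(y,y')\,dv_z(x,y)\,dv_{z'}(x',y').$$
   Context: $\mathscr{X},\mathscr{Y},\mathscr{Z}$ are measurable spaces with Borel $\sigma$-algebras. A semimetric is a function $\rho:\mathscr{X}\times\mathscr{X}\to[0,\infty)$ with $\rho(x,x')=0\Leftrightarrow x=x'$ and $\rho(x,x')=\rho(x',x)$. $\mathscr{H}_k$ is the RKHS with reproducing kernel $k$. $\mathcal{M}^{r}_{k}(\mathscr{X})$ is the set of finite signed Borel measures $v$ on $\mathscr{X}$ with $\int k^{r}(x,x)\,d|v|(x)<\infty$. $P_{XY|Z=z},P_{X|Z=z},P_{Y|Z=z}$ denote the conditional laws given $Z=z$, and $P_{X|Z=z}P_{Y|Z=z}$ is a product measure. $\|\cdot\|_{HS}$ and $\langle\cdot,\cdot\rangle_{HS}$ are the Hilbert-Schmidt norm and inner product. For each $z$, $\dot{\Sigma}_{YX|Z=z}:\mathscr{H}_{k_{\mathscr{X}}}\to\mathscr{H}_{k_{\mathscr{Y}}}$ is the bounded linear operator with $$\langle g,\dot{\Sigma}_{YX|Z=z}f\rangle_{\mathscr{H}_{k_{\mathscr{Y}}}}=\mathbb{E}[f(X)g(Y)|Z=z]-\mathbb{E}[f(X)|Z=z]\,\mathbb{E}[g(Y)|Z=z]$$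 for all $f\in\mathscr{H}_{k_{\mathscr{X}}}$, $g\in\mathscr{H}_{k_{\mathscr{Y}}}$; i.e. $\dot{\Sigma}_{YX|Z=z}=\int k_{\mathscr{Y}}(\cdot,y)\otimes k_{\mathscr{X}}(\cdot,x)\,dv_z(x,y)$. The random element $\ddot{X}=(X,Z)$ of $\mathscr{X}\times\mathscr{Z}$ is equipped with the product kernel $k_{\ddot{X}}((x,z),(x',z'))=k_{\mathscr{X}}(x,x')k_{\mathscr{Z}}(z,z')$ with RKHS $\mathscr{H}_{\ddot{X}}=\mathscr{H}_{k_{\mathscr{X}}}\otimes\mathscr{H}_{k_{\mathscr{Z}}}$. The conditional cross-covariance operator $\Sigma_{Y\ddot{X}|Z}:\mathscr{H}_{\ddot{X}}\to\mathscr{H}_{k_{\mathscr{Y}}}$ is the unique bounded linear operator with $$\langle g,\Sigma_{Y\ddot{X}|Z}f\rangle_{\mathscr{H}_{k_{\mathscr{Y}}}}=\mathbb{E}[f(\ddot{X})g(Y)]-\mathbb{E}_Z\big[\mathbb{E}[f(\ddot{X})|Z]\,\mathbb{E}[g(Y)|Z]\big]$$ for all $f\in\mathscr{H}_{\ddot{X}}$, $g\in\mathscr{H}_{k_{\mathscr{Y}}}$. *)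

(* Defs.v *)
From HB Require Import structures.
From mathcomp Require Import all_boot all_order all_algebra.
From mathcomp Require Import sesquilinear.
From mathcomp Require Import all_classical all_reals all_analysis.

Set Implicit Arguments.
Unset Strict Implicit.
Unset Printing Implicit Defensive.

Import Order.TTheory GRing.Theory Num.Theory.
Import numFieldNormedType.Exports.

Local Open Scope classical_set_scope.
Local Open Scope ring_scope.

HB.mixin Record isHilbert (R : realType) V & CompleteNormedModule R V := {
  hdot : {dot V for idfun} ;
  hdot_norm : forall v : V, hdot v v = `|v| ^+ 2 }.

#[short(type="hilbertType")]
HB.structure Definition Hilbert (R : realType) :=
  {V of CompleteNormedModule R V & isHilbert R V}.

Section Hilbert_operators.
Context {R : realType} {H G : hilbertType R}.

Definition bounded_op (A : H -> G) :=
  exists C : R, forall f : H, `|A f| <= C * `|f|.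

(* "Only 0 is orthogonal to E" is completeness of the orthonormal system; [E]
   may be uncountable, no separability being assumed. *)
Definition orthonormal_basis (E : set H) :=
  [/\ forall e, E e -> `|e| = 1,
      forall e e', E e -> E e' -> e != e' -> hdot e e' = 0 &
      forall f, (forall e, E e -> hdot f e = 0) -> f = 0].

Local Open Scope ereal_scope.

Definition hs_norm (E : set H) (A : H -> G) : \bar R :=
  sqrte (\esum_(e in E) (`|A e| ^+ 2)%:E).

(* [esum] only sums nonnegative families: the unordered sum of <A e, B e> over
   e in E is the sum of the positive parts minus that of the negative parts. *)
Definition hs_dot (E : set H) (A B : H -> G) : \bar R :=
  let F := fun e => (hdot (A e) (B e))%:E in
  \esum_(e in E) F^\+ e - \esum_(e in E) F^\- e.

End Hilbert_operators.

Section kernels.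
Context {R : realType}.

Definition posdef_kernel (T : Type) (k : T -> T -> R) :=
  (forall x x', k x x' = k x' x) /\
  (forall (n : nat) (c : 'I_n -> R) (x : 'I_n -> T),
    0 <= \sum_i \sum_j c i * c j * k (x i) (x j)).

Definition measurable_kernel2 d (T : measurableType d) (k : T -> T -> R) :=
  measurable_fun [set: T * T] (fun p => k p.1 p.2).

Definition prod_kernel (T U : Type) (k : T -> T -> R) (l : U -> U -> R)
  (p q : T * U) : R := k p.1 q.1 * l p.2 q.2.

(* The elements of the space are functions: [rkhs_fun] identifies them,
   injectively and linearly, with functions on T. *)
Record rkhs (T : Type) (k : T -> T -> R) := Rkhs {
  rkhs_space :> hilbertType R ;
  rkhs_fun : rkhs_space -> T -> R ;
  rkhs_fun_inj : injective rkhs_fun ;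
  rkhs_fun_linear : forall (a : R) (f g : rkhs_space) (x : T),
    rkhs_fun (a *: f + g) x = a * rkhs_fun f x + rkhs_fun g x ;
  rkhs_reproducing : forall x : T, exists kx : rkhs_space,
    (forall x', rkhs_fun kx x' = k x' x) /\
    (forall f : rkhs_space, hdot f kx = rkhs_fun f x) }.

Definition semimetric (T : Type) (rho : T -> T -> R) :=
  [/\ forall x x', 0 <= rho x x',
      forall x x', rho x x' = 0 <-> x = x' &
      forall x x', rho x x' = rho x' x].

Definition distance_induced (T : Type) (rho : T -> T -> R) (theta : T)
    (k : T -> T -> R) :=
  forall x x', k x x' = rho x theta + rho x' theta - rho x x'.

End kernels.

Section signed_measures.
Context d (T : measurableType d) (R : realType).
Implicit Type nu : {charge set T -> \bar R}.
Local Open Scope ereal_scope.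

Lemma hahn_exists nu :
  exists PN : set T * set T, hahn_decomposition nu PN.1 PN.2.
Proof. by have [P [N h]] := Hahn_decomposition nu; exists (P, N). Qed.

(* On measurable sets, the Jordan decomposition does not depend on the Hahn
   decomposition it is computed from. *)
Definition jpos nu : {finite_measure set T -> \bar R} :=
  jordan_pos (svalP (cid (hahn_exists nu))).
Definition jneg nu : {finite_measure set T -> \bar R} :=
  jordan_neg (svalP (cid (hahn_exists nu))).
Definition variation nu : {measure set T -> \bar R} :=
  charge_variation (svalP (cid (hahn_exists nu))).

Definition cintegral nu (f : T -> \bar R) : \bar R :=
  \int[jpos nu]_x f x - \int[jneg nu]_x f x.

Definition moment_class (r : R) (k : T -> T -> R) :=
  [set nu : {charge set T -> \bar R} | \int[variation nu]_x ((k x x) `^ r)%:E < +oo].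

End signed_measures.

Notation "\cint [ nu ]_ x f" := (cintegral nu (fun x => f))
  (at level 36, nu at level 10, x name, f at level 36,
   format "'[' \cint [ nu ]_ x '/  '  f ']'") : ereal_scope.

Section conditional_laws.
Context {R : realType}.
Local Open Scope ereal_scope.

Section conditioning.
Context dO dT dZ (Omega : measurableType dO) (T : measurableType dT)
  (Zs : measurableType dZ) (P : probability Omega R).

Definition cond_law (W : Omega -> T) (Z : {RV P >-> Zs})
    (K : Zs -> pprobability T R) :=
  measurable_fun [set: Zs] K /\
  forall (A : set T) (B : set Zs), measurable A -> measurable B ->
    P (W @^-1` A `&` Z @^-1` B) = \int[distribution P Z]_(z in B) K z A.

(* u(Z) is a version of E[F | Z]: the sigma-algebra of Z consists of the sets
   Z @^-1` B with B measurable. *)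
Definition cond_expectation (F : Omega -> R) (Z : {RV P >-> Zs})
    (u : Zs -> R) :=
  [/\ P.-integrable [set: Omega] (EFin \o F),
      measurable_fun [set: Zs] u,
      P.-integrable [set: Omega] (EFin \o (u \o Z)) &
      forall B, measurable B ->
        \int[P]_(w in Z @^-1` B) (u (Z w))%:E =
        \int[P]_(w in Z @^-1` B) (F w)%:E].

End conditioning.

Section marginals.
Context dX dY (Xs : measurableType dX) (Ys : measurableType dY).

Definition fst_mfun : Xs * Ys -> Xs := fst.
HB.instance Definition _ :=
  isMeasurableFun.Build _ _ _ _ fst_mfun measurable_fst.
Definition snd_mfun : Xs * Ys -> Ys := snd.
HB.instance Definition _ :=
  isMeasurableFun.Build _ _ _ _ snd_mfun measurable_snd.

Variable mu : probability (Xs * Ys)%type R.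

Definition marg1 : probability Xs R := distribution mu fst_mfun.
Definition marg2 : probability Ys R := distribution mu snd_mfun.

Definition marg_prod : probability (Xs * Ys)%type R := (marg1 \x marg2).

Definition dependence_charge : {charge set (Xs * Ys)%type -> \bar R} :=
  cadd (charge_of_finite_measure mu)
       (copp (charge_of_finite_measure marg_prod)).

Context (kX : Xs -> Xs -> R) (kY : Ys -> Ys -> R) (HX : rkhs kX) (HY : rkhs kY).

(* With mu the law of (X, Y) given Z = z, this says that S is the
   cross-covariance operator of X and Y given Z = z. *)
Definition is_cross_cov (S : HX -> HY) :=
  forall (f : HX) (g : HY),
    (hdot g (S f))%:E =
      'E_mu[fun p => (rkhs_fun f p.1 * rkhs_fun g p.2)%R]
      - 'E_marg1[rkhs_fun f] * 'E_marg2[rkhs_fun g].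

End marginals.

End conditional_laws.

Section conditional_cross_covariance.
Context {R : realType} dO dX dY dZ (Omega : measurableType dO)
  (Xs : measurableType dX) (Ys : measurableType dY) (Zs : measurableType dZ)
  (P : probability Omega R)
  (X : {RV P >-> Xs}) (Y : {RV P >-> Ys}) (Z : {RV P >-> Zs}).
Context (kX : Xs -> Xs -> R) (kY : Ys -> Ys -> R) (kZ : Zs -> Zs -> R)
  (HXZ : rkhs (prod_kernel kX kZ)) (HY : rkhs kY).
Local Open Scope ereal_scope.

(* [prod_kernel kX kZ] is the kernel of the tensor product of the RKHSs of kX
   and kZ, realized as functions on Xs * Zs. *)
Definition is_cond_cross_cov (S : HXZ -> HY) :=
  forall (f : HXZ) (g : HY) (u w : Zs -> R),
    cond_expectation (fun o => rkhs_fun f (X o, Z o)) Z u ->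
    cond_expectation (fun o => rkhs_fun g (Y o)) Z w ->
    (hdot g (S f))%:E =
      'E_P[fun o => (rkhs_fun f (X o, Z o) * rkhs_fun g (Y o))%R]
      - 'E_(distribution P Z)[fun z => (u z * w z)%R].

End conditional_cross_covariance.

Section h_function.
Context {R : realType} dX dY (Xs : measurableType dX) (Ys : measurableType dY).
Local Open Scope ereal_scope.

(* \int\int a(x,x') b(y,y') d nu(x,y) d nu'(x',y') *)
Definition double_cint (a : Xs -> Xs -> R) (b : Ys -> Ys -> R)
    (nu nu' : {charge set (Xs * Ys)%type -> \bar R}) : \bar R :=
  \cint[nu']_q \cint[nu]_p (a p.1 q.1 * b p.2 q.2)%:E.

End h_function.

(* Main.v *)
Require Import Defs.
From HB Require Import structures.
From mathcomp Require Import all_boot all_order all_algebra.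
From mathcomp Require Import sesquilinear finmap.
From mathcomp Require Import all_classical all_reals all_analysis.
From mathcomp Require Import measurable_realfun.
From mathcomp Require Import ring lra.
Set Implicit Arguments.
Unset Strict Implicit.
Unset Printing Implicit Defensive.
Import Order.TTheory GRing.Theory Num.Theory.
Import numFieldNormedType.Exports.
Local Open Scope classical_set_scope.
Local Open Scope ring_scope.

(** The cross-covariance operator of (X, Y) under a law mu is the expectation of
    rank-one operators. With an independent copy (X', Y'), the covariance formula
    Cov(f(X), g(Y)) = E[(f(X) - f(X')) (g(Y) - g(Y'))] / 2 gives
      <g, S f> = E[<f, al> <g, be>],  al = k_X - k_X',  be = (k_Y - k_Y') / 2,
    where k_x is the kernel section at x; al and be are the features of a sampled
    pair of points. The conditional operator has the same form: the sample
    consists of z, drawn from the law of Z, and of two independent draws from the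
    conditional law at z, and al = k_(X,z) - k_(X',z).

    For operators of this form the Hilbert-Schmidt product is the double integral
    of <al, al'> <be, be'> (hs_dot_feature_op). Formally this is Parseval's
    identity under the integral, but the spaces need not be separable and the sum
    over an uncountable basis cannot be exchanged with an integral. Instead,
    projections P_n on finitely many basis vectors are used: the finite sums are
    integrals of <S (P_n al), be>, they bound the Hilbert-Schmidt norm by the
    operator norm of S times an integrable function, and once S is known to be
    Hilbert-Schmidt the P_n can be chosen such that S P_n tends to S strongly
    (op_onb_proj_cvg), so that dominated convergence applies.

    At fixed z and z', <al, al'> <be, be'> is a quarter of the product of the
    second differences of kX and kY. Its double integral is h(z, z'), because an
    integral against the joint law minus the product of the marginals is the
    expectation of a mixed difference over two independent copies
    (cintegral_dependence, double_cint_resample). Second differences do not see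
    functions of one variable, so kX and kY may be replaced by -rhoX and -rhoY
    (double_cint_distance). For the conditional operator <al, al'> has the further
    factor kZ(z, z'), and disintegration together with Fubini's theorem brings
    the integrals over z and z' to the outside (hs_norm_cond_cross_cov).

    Everything is dominated through moment_bound, whose conditional expectation is
    finite for almost every z. At the exceptional z the given operators are
    arbitrary, and the integrands may fail to be measurable there; these z are
    removed by eq_integral_null, which holds for arbitrary integrands. *)

(** * Hilbert spaces and closed subspaces *)

Section hilbert.
Context {R : realType} {H : hilbertType R}.
Implicit Types u v w : H.

Lemma hdotC u v : hdot u v = hdot v u.
Proof. by have := hermC hdot u v; rewrite expr0 mul1r. Qed.

Lemma hdotDl u v w : hdot (u + v) w = hdot u w + hdot v w.
Proof. exact: linearDl. Qed.
Lemma hdotBl u v w : hdot (u - v) w = hdot u w - hdot v w.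
Proof. exact: linearBl. Qed.
Lemma hdotZl a u w : hdot (a *: u) w = a * hdot u w.
Proof. by rewrite linearZl_LR. Qed.
Lemma hdotDr u v w : hdot w (u + v) = hdot w u + hdot w v.
Proof. exact: linearDr. Qed.
Lemma hdotBr u v w : hdot w (u - v) = hdot w u - hdot w v.
Proof. exact: linearBr. Qed.
Lemma hdotZr a u w : hdot w (a *: u) = a * hdot w u.
Proof. by rewrite linearZr_LR. Qed.
Lemma hdot_suml I (r : seq I) (f : I -> H) w :
  hdot (\sum_(i <- r) f i) w = \sum_(i <- r) hdot (f i) w.
Proof. by rewrite linear_sumlz. Qed.
Lemma hdot_sumr I (r : seq I) (f : I -> H) w :
  hdot w (\sum_(i <- r) f i) = \sum_(i <- r) hdot w (f i).
Proof. by rewrite linear_sumr. Qed.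

Lemma normB_sqr u v : `|u - v| ^+ 2 = `|u| ^+ 2 - 2 * hdot u v + `|v| ^+ 2.
Proof. by rewrite -!hdot_norm !hdotBl !hdotBr (hdotC v u); lra. Qed.

Lemma hdot_cauchy_schwarz u v : `|hdot u v| <= `|u| * `|v|.
Proof.
have [->|v0] := eqVneq v 0; first by rewrite [hdot u 0]linear0r !normr0 mulr0.
have nv : 0 < `|v| by rewrite normr_gt0.
have nv2 : 0 < `|v| ^+ 2 by rewrite exprn_gt0.
have := sqr_ge0 `|u - (hdot u v / `|v| ^+ 2) *: v|.
rewrite normB_sqr hdotZr normrZ exprMn real_normK ?num_real// => h.
rewrite -(@ler_sqr R) ?nnegrE ?mulr_ge0// exprMn real_normK ?num_real//.
rewrite -subr_ge0.
suff -> : `|u| ^+ 2 * `|v| ^+ 2 - hdot u v ^+ 2 = (`|u| ^+ 2 -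
   2 * (hdot u v / `|v| ^+ 2 * hdot u v) + (hdot u v / `|v| ^+ 2) ^+ 2 * `|v| ^+ 2) * `|v| ^+ 2.
  by rewrite mulr_ge0// ltW.
by field; rewrite gt_eqF.
Qed.

Lemma parallelogram u v : `|u - v| ^+ 2 = 2 * `|u| ^+ 2 + 2 * `|v| ^+ 2 - `|u + v| ^+ 2.
Proof. by rewrite -!hdot_norm !hdotBl !hdotBr !hdotDl !hdotDr; lra. Qed.

(** Sequential closedness is enough in a metric space, and it is the form in which
    pointwise limits of functions enter. *)
Definition seq_closed (W : set H) := forall (s : nat -> H) l,
  (forall n, W (s n)) -> s @ \oo --> l -> W l.

Definition subspace (W : set H) := W 0 /\ forall a u v, W u -> W v -> W (a *: u + v).

(** A minimizing sequence for the distance from f to W is Cauchy by the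
    parallelogram law, so f has a nearest point p in W; then f - p is orthogonal to
    W, hence to E, hence zero. This one principle replaces density of spans,
    orthogonal projections and expansions in a basis: a property that is linear and
    closed holds everywhere once it holds on a total set. *)
Lemma total_closed_subspace (E W : set H) :
  (forall f, (forall e, E e -> hdot f e = 0) -> f = 0) ->
  E `<=` W -> subspace W -> seq_closed W -> forall f, W f.
Proof.
move=> Etot EW [W0 Wlin] Wcl f.
pose D : set R := [set `|f - w| ^+ 2 | w in W].
have D0 : D !=set0 by exists (`|f - 0| ^+ 2), 0.
have lbD : has_lbound D by exists 0 => _ [w _ <-]; exact: sqr_ge0.
have infD : has_inf D by split.
have d_le w : W w -> inf D <= `|f - w| ^+ 2 by move=> Ww; apply: ge_inf => //; exists w.
have /choice[s sP] (n : nat) : exists w, W w /\ `|f - w| ^+ 2 < inf D + n.+1%:R^-1.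
  have n0 : 0 < n.+1%:R^-1 :> R by rewrite invr_gt0.
  have [_ [w Ww <-] hw] := inf_adherent n0 infD.
  by exists w.
have s_dist n m : `|s n - s m| ^+ 2 <= 2 * n.+1%:R^-1 + 2 * m.+1%:R^-1.
  have [Wn dn] := sP n; have [Wm dm] := sP m.
  have -> : s n - s m = (f - s m) - (f - s n) by rewrite opprB [RHS]addrC addrA subrK.
  rewrite parallelogram.
  have Wmid : W (2^-1 *: s m + 2^-1 *: s n).
    by rewrite -[2^-1 *: s n]addr0; do 2 apply: (Wlin) => //.
  have := d_le _ Wmid.
  have -> : f - (2^-1 *: s m + 2^-1 *: s n) = 2^-1 *: ((f - s m) + (f - s n)).
    rewrite addrACA scalerDr -opprD scalerN [in RHS]scalerDr -scalerDl.
    by rewrite [2^-1 + 2^-1](_ : _ = 1) ?scale1r ?scalerDr//; lra.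
  rewrite normrZ exprMn ger0_norm// => hm.
  move: dn dm hm; rewrite (_ : 2^-1 ^+ 2 = 4^-1 :> R); last by field.
  move: (inf D) (_ ^+ 2) (_ ^+ 2) (_ ^+ 2) (n.+1%:R^-1) (m.+1%:R^-1) => i a b c p q.
  by lra.
have cs : cvg (s @ \oo).
  apply/cauchy_cvgP/cauchy_ballP => e e0.
  have e20 : 0 < e ^+ 2 by rewrite exprn_gt0.
  near \oo => N.
  have hN : 4 * N.+1%:R^-1 < e ^+ 2.
    rewrite -ltr_pdivlMl// -[X in _ < X]invrK ltf_pV2 ?posrE ?invr_gt0//; last first.
      by rewrite mulr_gt0.
    near: N; apply: filterS (nbhs_infty_gtr ((4^-1 * e ^+ 2)^-1)) => n /lt_trans; apply.
    by rewrite ltr_nat.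
  exists (s @` [set n | (N <= n)%N], s @` [set n | (N <= n)%N]) => /=.
    by split; exists N => // n Nn; exists n.
  move=> [_ _] [/= [n Nn <-] [m Nm <-]].
  rewrite -ball_normE /ball_/= -(@ltr_sqr R) ?nnegrE ?normr_ge0 ?(ltW e0)//.
  apply: le_lt_trans (s_dist _ _) _; apply: le_lt_trans hN.
  have h k : (N <= k)%N -> k.+1%:R^-1 <= N.+1%:R^-1 :> R.
    by move=> Nk; rewrite lef_pV2 ?posrE// ler_nat.
  move: (h _ Nn) (h _ Nm); move: (n.+1%:R^-1) (m.+1%:R^-1) (N.+1%:R^-1) => a b c.
  by lra.
move: cs => /cvg_ex[p sp].
have Wp : W p by apply: Wcl sp => n; exact: (sP n).1.
suff: f - p = 0 by move=> /subr0_eq ->.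
have p_min : `|f - p| ^+ 2 <= inf D.
  have h : `|f - s n| ^+ 2 @[n --> \oo] --> `|f - p| ^+ 2.
    rewrite expr2; under eq_cvg do rewrite expr2.
    by apply: cvgM; apply: cvg_norm; apply: cvgB => //; exact: cvg_cst.
  have h' : inf D + n.+1%:R^-1 @[n --> \oo] --> inf D + 0.
    apply: cvgD; [exact: cvg_cst|exact: cvg_harmonic].
  rewrite -[leRHS]addr0; apply: ler_cvg_to h h' _.
  by near=> n; exact/ltW/(sP n).2.
apply: Etot => e Ee.
have [-> | e0] := eqVneq e 0; first by rewrite [hdot _ 0]linear0r.
have ne2 : 0 < `|e| ^+ 2 by rewrite exprn_gt0// normr_gt0.
(* p + t e is the point nearest to f on the line through p along e *)
pose t := hdot (f - p) e / `|e| ^+ 2.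
have Wt : W (t *: e + p) by apply: Wlin => //; exact: EW.
have := le_trans p_min (d_le _ Wt).
rewrite [t *: e + p]addrC opprD addrA [leRHS]normB_sqr hdotZr normrZ exprMn real_normK ?num_real//.
rewrite -subr_le0.
have -> : `|f - p| ^+ 2 - (`|f - p| ^+ 2 - 2 * (t * hdot (f - p) e) + t ^+ 2 * `|e| ^+ 2) =
   hdot (f - p) e ^+ 2 / `|e| ^+ 2.
  by rewrite /t; field; rewrite gt_eqF// normr_gt0.
rewrite pmulr_lle0 ?invr_gt0// => h.
by apply/eqP; rewrite -sqrf_eq0 eq_le h sqr_ge0.
Unshelve. all: by end_near.
Qed.
End hilbert.

(** * Orthonormal bases of arbitrary cardinality *)

Section onb.
Context {R : realType} {H : hilbertType R}.
Variable (E : set H) (E_onb : orthonormal_basis E).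

Definition onb_proj (r : seq H) (w : H) : H := \sum_(e <- r) hdot w e *: e.

Variables (r : seq H) (ur : uniq r) (rE : forall e, e \in r -> E e).

Lemma hdot_onb_proj w e : e \in r -> hdot (onb_proj r w) e = hdot w e.
Proof.
have [E1 E0 _] := E_onb; move=> er; rewrite hdot_suml (bigD1_seq e)//=.
rewrite hdotZl hdot_norm E1 ?expr1n ?mulr1//; last exact: rE.
rewrite big_seq_cond big1 ?addr0// => e' /andP[e'r e'e].
by rewrite hdotZl E0 ?mulr0//; exact: rE.
Qed.

(** With onb_proj_in: the projection acts on each basis vector as the indicator of
    r, which is all that is needed to test strong convergence on the basis. *)
Lemma onb_proj_notin e : E e -> e \notin r -> onb_proj r e = 0.
Proof.
have [_ E0 _] := E_onb; move=> Ee er; rewrite /onb_proj big_seq big1// => e' e'r.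
rewrite E0 ?scale0r//; first exact: rE.
by apply: contraNneq er => ->.
Qed.

Lemma onb_proj_in e : e \in r -> onb_proj r e = e.
Proof.
have [E1 E0 _] := E_onb; move=> er; rewrite /onb_proj (bigD1_seq e)//=.
rewrite hdot_norm E1 ?expr1n ?scale1r//; last exact: rE.
rewrite big_seq_cond big1 ?addr0// => e' /andP[e'r e'e].
by rewrite E0 ?scale0r//; [exact: rE..|rewrite eq_sym].
Qed.

(** Bessel's inequality; the bound does not depend on the finite set r, so that
    strong limits along finite sets pass to closures. *)
Lemma norm_onb_proj_le w : `|onb_proj r w| <= `|w|.
Proof.
have h : hdot w (onb_proj r w) = `|onb_proj r w| ^+ 2.
  rewrite -hdot_norm [in RHS]/onb_proj hdot_sumr /onb_proj hdot_sumr.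
  apply: eq_big_seq => e er; rewrite !hdotZr.
  by rewrite -[X in _ = _ * hdot X e]/(onb_proj r w) hdot_onb_proj.
have := sqr_ge0 `|w - onb_proj r w|.
by rewrite normB_sqr h => h2; rewrite -(@ler_sqr R) ?nnegrE//; lra.
Qed.

End onb.

Section summable_family.
Context {R : realType} {T : choiceType}.
Local Open Scope ereal_scope.

(** The same finite sets exhaust, up to 1/(n+1), every family dominated by a
    summable one. They take the place of an enumeration of the support. *)
Lemma esum_approx (E : set T) (a : T -> R) : (forall e, E e -> 0 <= a e)%R ->
  \esum_(e in E) (a e)%:E < +oo ->
  exists r : nat -> seq T, forall n, [/\ uniq (r n), forall e, e \in r n -> E e &
    forall b : T -> R, (forall e, E e -> 0 <= b e <= a e)%R ->
      \sum_(e <- r n) (b e)%:E <= \esum_(e in E) (b e)%:E /\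
      \esum_(e in E) (b e)%:E <= \sum_(e <- r n) (b e)%:E + (n.+1%:R^-1)%:E ].
Proof.
move=> a0 aoo.
have afin : \esum_(e in E) (a e)%:E \is a fin_num.
  by rewrite ge0_fin_numE// esum_ge0.
(* any finite set nearly reaching the supremum for a leaves a tail below 1/(n+1) *)
suff /choice[r rP] : forall n : nat, exists r : seq T,
  [/\ uniq r, forall e, e \in r -> E e &
    forall b : T -> R, (forall e, E e -> 0 <= b e <= a e)%R ->
      \sum_(e <- r) (b e)%:E <= \esum_(e in E) (b e)%:E /\
      \esum_(e in E) (b e)%:E <= \sum_(e <- r) (b e)%:E + (n.+1%:R^-1)%:E ].
  by exists r.
move=> n.
have n0 : (0 < n.+1%:R^-1 :> R)%R by rewrite invr_gt0.
have [_ [F [finF FE] <-] hF] := ub_ereal_sup_adherent n0 afin.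
have splitE (b : T -> R) : (forall e, E e -> 0 <= b e)%R ->
    \esum_(e in E) (b e)%:E = \sum_(e <- fset_set F) (b e)%:E + \esum_(e in E `&` ~` F) (b e)%:E.
  move=> b0; rewrite (esumID F)//; congr (_ + _).
    rewrite setIidr// esum_fset//; last by move=> e; rewrite inE => /FE/b0; rewrite lee_fin.
    by rewrite fsbig_finite.
exists (fset_set F); split.
- exact: fset_uniq.
- by move=> e; rewrite in_fset_set// inE; exact: FE.
- move=> b b0.
  have b0' e : E e -> (0 <= b e)%R by move=> /b0/andP[].
  rewrite (splitE b)//; split; first by rewrite leeDl// esum_ge0// => e [/b0'].
  rewrite leeD2l//.
  apply: (@le_trans _ _ (\esum_(e in E `&` ~` F) (a e)%:E)).
    by apply: le_esum => e [/b0/andP[_]]; rewrite lee_fin.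
  move: hF; rewrite -/(esum E _) (splitE a)// fsbig_finite//=.
  rewrite EFinN lteBlDr// lteD2lE//; last by rewrite sumEFin.
  exact: ltW.
Qed.
End summable_family.

Lemma onb_projP (R : realType) (H : hilbertType R) (r : seq H) a (u v : H) :
  onb_proj r (a *: u + v) = a *: onb_proj r u + onb_proj r v.
Proof.
rewrite /onb_proj scaler_sumr -big_split/=; apply: eq_bigr => e _.
by rewrite hdotDl hdotZl scalerDl scalerA.
Qed.

Lemma bounded_op_nonneg (R : realType) (H G : hilbertType R) (S : H -> G) :
  bounded_op S -> exists2 C, 0 <= C & forall f, `|S f| <= C * `|f|.
Proof.
move=> [C hC]; exists `|C| => // f; apply: le_trans (hC f) _.
by rewrite ler_wpM2r// ler_norm.
Qed.

Section basis_approximation.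
Context {R : realType} {H G : hilbertType R}.
Variables (E : set H) (E_onb : orthonormal_basis E).
Variables (S : {linear H -> G}) (S_bdd : bounded_op S).
Variables (r : nat -> seq H) (delta : nat -> R).
Hypothesis ur : forall n, uniq (r n).
Hypothesis rE : forall n e, e \in r n -> E e.
Hypothesis delta0 : delta @ \oo --> 0.
Hypothesis S_small : forall n e, E e -> e \notin r n -> `|S e| <= delta n.

(** The vectors w along which the convergence holds form a closed subspace, by the
    uniform bound of Bessel's inequality. It contains the basis, however large,
    because S is uniformly small on the basis vectors that r n misses. *)
Lemma op_onb_proj_cvg w : S (onb_proj (r n) w) @[n --> \oo] --> S w.
Proof.
have [C C0 SC] := bounded_op_nonneg S_bdd.
have [_ _ Etot] := E_onb.
pose W := [set w | S (onb_proj (r n) w) @[n --> \oo] --> S w].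
suff: W w by []. apply: (total_closed_subspace Etot).
- move=> e Ee; apply/cvgrPdist_le => eps eps0.
  move/cvgrPdist_le : delta0 => /(_ _ eps0); apply: filterS => n.
  rewrite sub0r normrN => hn; have [er|er] := boolP (e \in r n).
    by rewrite (onb_proj_in E_onb)// ?subrr ?normr0 ?ltW//; exact: rE.
  rewrite (onb_proj_notin E_onb)//; last exact: rE.
  rewrite linear0 subr0; apply: le_trans (S_small Ee er) _.
  exact: le_trans (ler_norm _) hn.
- split=> [|a u v]; rewrite /W/=.
    have proj0 n : onb_proj (r n) 0 = 0.
      by rewrite /onb_proj big1// => e _; rewrite [hdot 0 e]linear0l scale0r.
    by under eq_cvg do rewrite proj0 linear0; rewrite linear0; exact: cvg_cst.
  move=> Wu Wv; under eq_cvg do rewrite onb_projP linearP.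
  by rewrite linearP; apply: cvgD => //; apply: cvgZr.
- move=> s l Ws sl; apply/cvgrPdist_le => eps eps0.
  have e3 : 0 < eps / 3 by rewrite divr_gt0.
  have eC : 0 < eps / (3 * (C + 1)) by rewrite divr_gt0// mulr_gt0// ltr_pwDr.
  have [k _ /(_ k (leqnn k)) hk] : \forall k \near \oo, `|l - s k| <= eps / (3 * (C + 1)).
    by move/cvgrPdist_le : sl; exact.
  have Chk : C * `|l - s k| <= eps / 3.
    apply: le_trans (ler_wpM2l C0 hk) _.
    have -> : eps / 3 = eps / (3 * (C + 1)) * (C + 1).
      by field; rewrite gt_eqF// ltr_pwDr.
    by rewrite mulrC ler_wpM2l ?lerDl// ltW.
  move/cvgrPdist_le : (Ws k) => /(_ _ e3); apply: filterS => n hn.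
  have -> : S l - S (onb_proj (r n) l) =
    S (l - s k) + (S (s k) - S (onb_proj (r n) (s k))) + S (onb_proj (r n) (s k - l)).
    have -> : onb_proj (r n) (s k - l) = onb_proj (r n) (s k) - onb_proj (r n) l.
      by rewrite addrC -scaleN1r onb_projP scaleN1r addrC.
    by rewrite !linearB/= !addrA !subrK.
  apply: le_trans (ler_normD _ _) _.
  have h1 := ler_normD (S (l - s k)) (S (s k) - S (onb_proj (r n) (s k))).
  have h2 := SC (l - s k).
  have h3 : `|S (onb_proj (r n) (s k - l))| <= C * `|l - s k|.
    apply: le_trans (SC _) _; rewrite ler_wpM2l// distrC.
    apply: (norm_onb_proj_le E_onb) => //; exact: rE.
  move: hn Chk h1 h2 h3.
  move: `|_| `|_| `|_| `|_| (C * _)  => *; lra.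
Qed.
End basis_approximation.

(** * Hilbert-Schmidt products of operators given by weak integrals *)

Lemma cvg_hdotl (R : realType) (H : hilbertType R) (u : nat -> H) (l v : H) :
  u @ \oo --> l -> hdot (u n) v @[n --> \oo] --> hdot l v.
Proof.
move=> ul; apply/cvgrPdist_le => eps eps0.
have e0 : 0 < eps / (`|v| + 1) by rewrite divr_gt0// ltr_pwDr.
move/cvgrPdist_le : ul => /(_ _ e0); apply: filterS => n hn.
rewrite -hdotBl; apply: le_trans (hdot_cauchy_schwarz _ _) _.
apply: (@le_trans _ _ (`|l - u n| * (`|v| + 1))); first by rewrite ler_wpM2l// lerDl.
by rewrite -ler_pdivlMr// ltr_pwDr.
Qed.

Section feature_operators.
Context {R : realType} d (W : measurableType d) {H G : hilbertType R}.
Variables (al : W -> H) (be : W -> G) (D : W -> R).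
Hypothesis mal : forall f, measurable_fun [set: W] (fun w => hdot f (al w)).
Hypothesis mbe : forall g, measurable_fun [set: W] (fun w => hdot g (be w)).
Hypothesis alberD : forall w, `|al w| * `|be w| <= D w.

(** S is the weak integral of the rank-one operators f |-> <f, al w> be w against
    m. Stating it through scalar integrals covers nonseparable spaces, where the
    Bochner integral of these operators may not exist. *)
Definition feature_op (m : {measure set W -> \bar R}) (S : H -> G) :=
  forall f g, (hdot g (S f))%:E = (\int[m]_w (hdot f (al w) * hdot g (be w))%:E)%E.

Lemma feature_le f g w : `|hdot f (al w) * hdot g (be w)| <= `|f| * `|g| * D w.
Proof.
rewrite normrM; apply: (@le_trans _ _ ((`|f| * `|al w|) * (`|g| * `|be w|))).
  by rewrite ler_pM// hdot_cauchy_schwarz.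
by rewrite mulrACA ler_wpM2l// mulr_ge0.
Qed.

Section one_measure.
Variables (m : {measure set W -> \bar R}).
Hypothesis intD : m.-integrable [set: W] (EFin \o D).

Lemma feature_integrable f g :
  m.-integrable [set: W] (fun w => (hdot f (al w) * hdot g (be w))%:E).
Proof.
apply: (@le_integrable _ _ _ _ _ measurableT _ (fun w => (`|f| * `|g|)%:E * (D w)%:E)%E).
- by apply/measurable_EFinP/measurable_funM.
- move=> w _; rewrite -EFinM !abse_EFin lee_fin.
  by apply: le_trans (feature_le _ _ _) _; rewrite ler_norm.
- exact: integrableZl.
Qed.

Variables (E : set H) (E_onb : orthonormal_basis E).
Variables (S : {linear H -> G}) (S_bdd : bounded_op S) (mS : feature_op m S).

Section finite_sums.
Variables (r : seq H) (ur : uniq r) (rE : forall e, e \in r -> E e).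

Lemma hdot_op_onb_proj (T : {linear H -> G}) w :
  hdot (T (onb_proj r (al w))) (be w) =
  \sum_(e <- r) hdot e (al w) * hdot (T e) (be w).
Proof.
rewrite /onb_proj linear_sum hdot_suml; apply: eq_bigr => e _.
by rewrite linearZ hdotZl [hdot (al w) e]hdotC.
Qed.

Lemma hdot_op_onb_proj_le (T : {linear H -> G}) C w : 0 <= C ->
  (forall f, `|T f| <= C * `|f|) ->
  `|hdot (T (onb_proj r (al w))) (be w)| <= C * D w.
Proof.
move=> C0 TC; apply: le_trans (hdot_cauchy_schwarz _ _) _.
apply: (@le_trans _ _ (C * `|al w| * `|be w|)).
  rewrite ler_wpM2r//; apply: le_trans (TC _) _.
  by rewrite ler_wpM2l//; apply: (norm_onb_proj_le E_onb).
by rewrite -mulrA ler_wpM2l.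
Qed.

(** Interchanging a finite sum over the basis with the integral is free; the sum
    over the basis inside the integral is the compression T (onb_proj r (al w)). *)
Lemma sum_hdot_feature_op (T : {linear H -> G}) :
  (\sum_(e <- r) (hdot (T e) (S e))%:E =
   \int[m]_w (hdot (T (onb_proj r (al w))) (be w))%:E)%E.
Proof.
under eq_bigr do rewrite mS.
rewrite -integral_sum//; last by move=> e; exact: feature_integrable.
by apply: eq_integral => w _; rewrite hdot_op_onb_proj sumEFin.
Qed.

End finite_sums.

(** A sum of |S e|^2 over finitely many basis vectors is the integral of
    <S (P al), be>, with P a projection of norm at most 1, hence at most the
    operator norm of S times the integral of the bound D. *)
Lemma feature_op_summable : (\esum_(e in E) (`|S e| ^+ 2)%:E < +oo)%E.
Proof.
have [C C0 SC] := bounded_op_nonneg S_bdd.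
have finD : (\int[m]_w (C%:E * (D w)%:E) \is a fin_num)%E.
  by apply: integrable_fin_num => //; exact: integrableZl.
apply: (@le_lt_trans _ _ (\int[m]_w (C%:E * (D w)%:E))%E); last first.
  by rewrite ltey_eq finD.
apply: ub_ereal_sup => _ [F [finF FE] <-].
rewrite fsbig_finite//=.
have rE e : e \in (fset_set F : seq H) -> E e.
  by rewrite in_fset_set// inE => /FE.
have ur : uniq (fset_set F : seq H) := fset_uniq _.
under eq_bigr do rewrite -hdot_norm.
rewrite sum_hdot_feature_op//; apply: le_integral => //.
- under eq_fun do rewrite hdot_op_onb_proj -sumEFin.
  by apply: integrable_sum => // e _; exact: feature_integrable.
- exact: integrableZl.
- move=> w _; rewrite -EFinM lee_fin; apply: le_trans (ler_norm _) _.
  exact: hdot_op_onb_proj_le.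
Qed.

End one_measure.

Variables (E : set H) (E_onb : orthonormal_basis E).

(** Over finite sets of basis vectors, the sum of the <S e, S' e> is the
    m'-integral of <S (P_n al'), be'>. Both operators are Hilbert-Schmidt, so finite
    sets can be chosen along which these sums tend to the Hilbert-Schmidt product
    while P_n is replaced by the identity in the limit; dominated convergence gives
    the integral of <S al', be'>, and the definition of S as a weak integral
    expands this once more. Parseval's identity is never applied under the
    integral, which an uncountable basis would not allow. *)
Theorem hs_dot_feature_op (m m' : {measure set W -> \bar R}) (S S' : {linear H -> G}) :
  m.-integrable [set: W] (EFin \o D) -> m'.-integrable [set: W] (EFin \o D) ->
  bounded_op S -> bounded_op S' -> feature_op m S -> feature_op m' S' ->
  (hs_dot E S S' =
   \int[m']_w' \int[m]_w (hdot (al w') (al w) * hdot (be w') (be w))%:E)%E.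
Proof.
move=> intD intD' Sb Sb' mS mS'.
transitivity (\int[m']_w' (hdot (S (al w')) (be w'))%:E)%E; last first.
  by apply: eq_integral => w' _; rewrite hdotC mS.
pose a e : R := `|S e| ^+ 2 + `|S' e| ^+ 2.
have a0 e : E e -> 0 <= a e by move=> _; rewrite addr_ge0.
have aoo : (\esum_(e in E) (a e)%:E < +oo)%E.
  under eq_esum do rewrite EFinD.
  rewrite esumD//.
  by rewrite lte_add_pinfty//; [exact: feature_op_summable mS|exact: feature_op_summable mS'].
have [r rP] := esum_approx a0 aoo.
have ur n : uniq (r n) by have [] := rP n.
have rE n e : e \in r n -> E e by have [_ h _] := rP n; exact: h.
pose F e : R := hdot (S e) (S' e).
have F_le e : `|F e| <= a e.
  apply: le_trans (hdot_cauchy_schwarz _ _) _; rewrite /a.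
  have := sqr_ge0 (`|S e| - `|S' e|); have := sqr_ge0 (`|S e|); have := sqr_ge0 (`|S' e|).
  by rewrite sqrrB; move: `|S e| `|S' e| => x y; lra.
have Fpos e : E e -> 0 <= F^\+ e <= a e.
  move=> Ee; rewrite /funrpos le_max lexx orbT/= ge_max (a0 _ Ee) andbT.
  exact: le_trans (ler_norm _) (F_le e).
have Fneg e : E e -> 0 <= F^\- e <= a e.
  move=> Ee; rewrite /funrneg le_max lexx orbT/= ge_max (a0 _ Ee) andbT.
  by apply: le_trans (F_le e); rewrite -normrN ler_norm.
have fin b : (forall e, E e -> 0 <= b e <= a e) -> (\esum_(e in E) (b e)%:E \is a fin_num)%E.
  move=> b0; rewrite ge0_fin_numE; last by apply: esum_ge0 => e /b0/andP[]; rewrite lee_fin.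
  by apply: le_lt_trans aoo; apply: le_esum => e /b0/andP[_]; rewrite lee_fin.
have cvg_sum b : (forall e, E e -> 0 <= b e <= a e) ->
    (\sum_(e <- r n) b e @[n --> \oo] --> fine (\esum_(e in E) (b e)%:E)).
  move=> b0; have := fin _ b0.
  move=> /fineK; set s := fine _ => sE.
  apply: (@squeeze_cvgr _ _ _ _ (fun n => s - n.+1%:R^-1) (fun=> s)); last 2 first.
  - by rewrite -[X in _ --> X]subr0; apply: cvgB; [exact: cvg_cst|exact: cvg_harmonic].
  - exact: cvg_cst.
  near=> n; have [_ _ /(_ b b0)] := rP n.
  by rewrite -sE sumEFin !lee_fin lerBlDr => -[-> ->].
have hsE : hs_dot E S S' = (fine (\esum_(e in E) (F^\+ e)%:E) - fine (\esum_(e in E) (F^\- e)%:E))%:E.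
  rewrite EFinB !fineK ?fin//.
  rewrite /hs_dot; congr (_ - _)%E; apply: eq_esum => e _.
    by rewrite -[LHS]/((EFin \o F)^\+%E e) funerpos.
  by rewrite -[LHS]/((EFin \o F)^\-%E e) funerneg.
have lim1 : (\sum_(e <- r n) (hdot (S e) (S' e))%:E @[n --> \oo] --> hs_dot E S S')%E.
  rewrite hsE; under eq_cvg do rewrite sumEFin.
  apply: cvg_EFin; first by near=> n.
  apply: cvg_trans (cvgB (cvg_sum _ Fpos) (cvg_sum _ Fneg)).
  apply: near_eq_cvg; near=> n.
  transitivity (\sum_(e <- r n) F^\+ e - \sum_(e <- r n) F^\- e) => //.
  rewrite -sumrB; apply: eq_bigr => e _.
  by have := congr1 (fun g => g e) (funrposBneg F).
rewrite -(cvg_lim (@ereal_hausdorff R) lim1); apply/cvg_lim => //.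
under eq_cvg do rewrite (sum_hdot_feature_op intD' mS').
have [C C0 SC] := bounded_op_nonneg Sb.
apply: (@dominated_cvg _ _ _ _ _ measurableT _ _ (fun w => C%:E * (D w)%:E)%E) => //.
- move=> n; apply/measurable_EFinP; under eq_fun do rewrite hdot_op_onb_proj.
  by apply: measurable_sum => e; exact: measurable_funM.
- move=> w _; apply: cvg_EFin; first by near=> n.
  have cS : S (onb_proj (r n) (al w)) @[n --> \oo] --> S (al w).
    apply: (@op_onb_proj_cvg _ _ _ _ E_onb _ Sb _ (fun n => Num.sqrt n.+1%:R^-1)) => //.
      rewrite -[X in _ --> X](@sqrtr0 R).
      apply: (continuous_cvg _ (@sqrt_continuous R 0)); exact: cvg_harmonic.
    (* the family supported at e is dominated and its sum over r n is 0 *)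
    move=> n e Ee er; rewrite -(@ler_sqr R) ?nnegrE// ?sqrtr_ge0// sqr_sqrtr ?invr_ge0//.
    have [_ _ /(_ (fun e' => if e' == e then `|S e| ^+ 2 else 0))] := rP n.
    case=> [|_].
      move=> e' Ee'; case: eqP => [->|_]; last by rewrite lexx a0.
      by rewrite sqr_ge0 lerDl sqr_ge0.
    rewrite big_seq big1 ?add0e; last first.
      by move=> e' e'r; case: eqP e'r er => // -> ->.
    rewrite -lee_fin; apply: le_trans; apply: esum_ge; exists [set e].
      by split=> [|_ ->]; [exact: finite_set1|].
    by rewrite fsbig_set1 eqxx.
  exact: cvg_hdotl.
- exact: integrableZl.
- by move=> n w _; rewrite abse_EFin -EFinM lee_fin; exact: (hdot_op_onb_proj_le E_onb (ur n) (rE n)).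
Unshelve. all: by end_near.
Qed.

End feature_operators.

(** * Reproducing kernel Hilbert spaces of measurable kernels *)

Lemma hs_norm_sqr (R : realType) (H G : hilbertType R) (E : set H) (A : H -> G) :
  (hs_norm E A ^+ 2 = hs_dot E A A)%E.
Proof.
rewrite /hs_norm sqr_sqrte; last by apply: esum_ge0.
rewrite /hs_dot [X in (_ - X)%E]esum1 ?sube0.
  by apply: eq_esum => e _; rewrite funeposE hdot_norm max_l.
by move=> e _; rewrite funenegE hdot_norm max_r// leeNl oppe0 lee_fin.
Qed.

Section rkhs_theory.
Context {R : realType} {T : Type} {k : T -> T -> R} (H : rkhs k).

Definition kernel_section (x : T) : H := projT1 (cid (rkhs_reproducing H x)).

Lemma hdot_kernel_section (f : H) x : hdot f (kernel_section x) = rkhs_fun f x.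
Proof. exact: (projT2 (cid (rkhs_reproducing H x))).2. Qed.

Lemma hdot_kernel_sections x x' :
  hdot (kernel_section x) (kernel_section x') = k x x'.
Proof.
rewrite hdotC hdot_kernel_section.
exact: (projT2 (cid (rkhs_reproducing H x'))).1.
Qed.

Lemma norm_kernel_section x : `|kernel_section x| ^+ 2 = k x x.
Proof. by rewrite -hdot_norm hdot_kernel_sections. Qed.

Lemma rkhs_kernel_ge0 x : 0 <= k x x.
Proof. by rewrite -norm_kernel_section sqr_ge0. Qed.

(** A function orthogonal to all kernel sections vanishes at every point by the
    reproducing property. *)
Lemma kernel_sections_total (f : H) :
  (forall e, range kernel_section e -> hdot f e = 0) -> f = 0.
Proof.
move=> f0; apply: (@rkhs_fun_inj _ _ _ H); apply/funext => x.
rewrite -!hdot_kernel_section f0; last by exists x.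
by rewrite [RHS]linear0l.
Qed.

End rkhs_theory.

Lemma measurable_kernel2_comp (R : realType) d d' (T : measurableType d)
    (U : measurableType d') (k : T -> T -> R) (f g : U -> T) :
  measurable_kernel2 k -> measurable_fun [set: U] f -> measurable_fun [set: U] g ->
  measurable_fun [set: U] (fun u => k (f u) (g u)).
Proof.
move=> mk mf mg; pose k' := fun p : T * T => k p.1 p.2.
have mk' : measurable_fun [set: T * T] k' by exact: mk.
exact: (measurableT_comp mk' (measurable_fun_pair mf mg)).
Qed.

(** Measurable members form a closed subspace, because convergence in the space
    implies pointwise convergence, and it contains the kernel sections. *)
Lemma measurable_rkhs_fun (R : realType) d (T : measurableType d)
    (k : T -> T -> R) (H : rkhs k) (f : H) :
  measurable_kernel2 k -> measurable_fun [set: T] (rkhs_fun f).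
Proof.
move=> mk; pose W : set H := [set f | measurable_fun [set: T] (rkhs_fun f)].
suff : W f by []. apply: (total_closed_subspace (@kernel_sections_total R T k H)).
- move=> _ [x _ <-]; rewrite /W/=.
  rewrite [X in measurable_fun _ X](_ : _ = k ^~ x); first exact: measurable_kernel2_comp.
  apply/funext => x'.
  by rewrite -hdot_kernel_section hdotC hdot_kernel_sections.
- split=> [|a u v Wu Wv]; rewrite /W/=.
    rewrite [X in measurable_fun _ X](_ : _ = cst 0)//.
    by apply/funext => x; rewrite -hdot_kernel_section [LHS]linear0l.
  rewrite [X in measurable_fun _ X](_ : _ = (fun x => a * rkhs_fun u x + rkhs_fun v x)).
    by apply: measurable_funD => //; exact: measurable_funM.
  by apply/funext => x; rewrite rkhs_fun_linear.
- move=> s l Ws sl; apply: (measurable_fun_cvg Ws) => x _.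
  under eq_cvg do rewrite -hdot_kernel_section.
  by rewrite -hdot_kernel_section; exact: cvg_hdotl.
Qed.

Lemma measurable_prod_kernel (R : realType) d d' (T : measurableType d)
    (U : measurableType d') (k : T -> T -> R) (l : U -> U -> R) :
  measurable_kernel2 k -> measurable_kernel2 l -> measurable_kernel2 (prod_kernel k l).
Proof.
move=> mk ml; apply: measurable_funM; apply: measurable_kernel2_comp => //;
  exact: measurableT_comp.
Qed.

(** * Image laws and integrals against a difference of measures *)

Lemma sube_swap (R : realDomainType) (a b c d : \bar R) :
  a \is a fin_num -> b \is a fin_num -> c \is a fin_num -> d \is a fin_num ->
  (a - b = c - d <-> a + d = c + b)%E.
Proof.
move: a b c d => [a| |] [b| |] [c| |] [d| |]//= _ _ _ _.
by rewrite -!EFinB -!EFinD; split=> -[h]; congr (_%:E); lra.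
Qed.

Section image_law.
Local Open Scope ereal_scope.
Context {R : realType} d1 d2 (T1 : measurableType d1) (T2 : measurableType d2).
Variables (m1 : {measure set T1 -> \bar R}) (m2 : {measure set T2 -> \bar R}).
Variables (phi : T1 -> T2) (mphi : measurable_fun [set: T1] phi).
Hypothesis phi_law : forall A, measurable A -> m1 (phi @^-1` A) = m2 A.

Let phi_mixin := isMeasurableFun.Build _ _ _ _ _ mphi.
Let phi_pack : {mfun T1 >-> T2} := HB.pack phi phi_mixin.

Lemma ge0_integral_image_law (f : T2 -> \bar R) : measurable_fun [set: T2] f ->
  (forall y, 0 <= f y) -> \int[m2]_y f y = \int[m1]_x f (phi x).
Proof.
move=> mf f0; rewrite (_ : (fun x => _) = f \o phi_pack)//.
rewrite -[RHS](@ge0_integral_pushforward _ _ _ _ _ phi mphi m1 setT f)//.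
by apply: eq_measure_integral => A mA _; rewrite -phi_law.
Qed.

Lemma integral_image_law (f : T2 -> \bar R) : measurable_fun [set: T2] f ->
  \int[m2]_y f y = \int[m1]_x f (phi x).
Proof.
move=> mf; rewrite integralE [RHS]integralE.
rewrite (ge0_integral_image_law (measurable_funepos mf))//.
rewrite (ge0_integral_image_law (measurable_funeneg mf))//.
by congr (_ - _); apply: eq_integral => x _; rewrite ?funeposE ?funenegE.
Qed.

Lemma integrable_image_law (f : T2 -> \bar R) : measurable_fun [set: T2] f ->
  m2.-integrable [set: T2] f <-> m1.-integrable [set: T1] (f \o phi).
Proof.
move=> mf; have mf' : measurable_fun [set: T1] (f \o phi) by exact: measurableT_comp.
have E : \int[m2]_y `|f y| = \int[m1]_x `|(f \o phi) x|.
  by rewrite ge0_integral_image_law//; exact: measurableT_comp.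
by split => /integrableP[_ foo]; apply/integrableP; split => //; rewrite -?E// E.
Qed.

End image_law.

Section charge_difference.
Local Open Scope ereal_scope.
Context {R : realType} d (T : measurableType d).
Variables (m1 m2 : {finite_measure set T -> \bar R}).

Let nu : {charge set T -> \bar R} :=
  cadd (charge_of_finite_measure m1) (copp (charge_of_finite_measure m2)).

Let nuE A : nu A = m1 A - m2 A. Proof. by []. Qed.

Let jpos_le A : measurable A -> jpos nu A <= m1 A.
Proof.
move=> mA; have [[mP _] _ _ _] := svalP (cid (hahn_exists nu)).
have -> : jpos nu A = nu (A `&` (sval (cid (hahn_exists nu))).1).
  by transitivity (crestr0 nu mP A) => //; rewrite /crestr0 mem_set.
rewrite nuE.
rewrite (@le_trans _ _ (m1 (A `&` (sval (cid (hahn_exists nu))).1)))//.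
  by rewrite leeBlDr ?leeDl// fin_num_measure//; exact: measurableI.
by rewrite le_measure// inE//; exact: measurableI.
Qed.

Let jneg_le A : measurable A -> jneg nu A <= m2 A.
Proof.
move=> mA; have [_ [mN _] _ _] := svalP (cid (hahn_exists nu)).
have -> : jneg nu A = - nu (A `&` (sval (cid (hahn_exists nu))).2).
  transitivity (cscale (-1) (crestr0 nu mN) A) => //.
  by rewrite cscaleN1/= /crestr0 mem_set.
rewrite nuE.
rewrite (@le_trans _ _ (m2 (A `&` (sval (cid (hahn_exists nu))).2)))//.
  rewrite fin_num_oppeB; last by rewrite ?fin_numN fin_num_measure//; exact: measurableI.
  by rewrite addeC leeBlDr ?leeDl// fin_num_measure//; exact: measurableI.
by rewrite le_measure// inE//; exact: measurableI.
Qed.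

(** From jpos + m2 = m1 + jneg one can integrate both sides as measures. The
    integrals against jpos and jneg are finite because the Jordan decomposition is
    the smallest one: jpos is below m1 and jneg below m2. *)
Lemma cintegral_difference (f : T -> \bar R) :
  m1.-integrable [set: T] f -> m2.-integrable [set: T] f ->
  \cint[nu]_x f x = \int[m1]_x f x - \int[m2]_x f x.
Proof.
move=> /[dup] int1 /integrableP[mf foo1] /[dup] int2 /integrableP[_ foo2].
have intp : (jpos nu).-integrable [set: T] f.
  apply/integrableP; split => //; apply: le_lt_trans foo1.
  by apply: ge0_le_measure_integral => //; exact: measurableT_comp.
have intn : (jneg nu).-integrable [set: T] f.
  apply/integrableP; split => //; apply: le_lt_trans foo2.
  by apply: ge0_le_measure_integral => //; exact: measurableT_comp.
have : \int[measure_add (jpos nu) m2]_x f x = \int[measure_add m1 (jneg nu)]_x f x.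
  apply: eq_measure_integral => A mA _; rewrite [LHS]measure_addE [RHS]measure_addE.
  have h : m1 A - m2 A = jpos nu A - jneg nu A.
    by rewrite -nuE (jordan_decomp (svalP (cid (hahn_exists nu))) mA) /cadd/= cscaleN1.
  by apply: (sube_swap _ _ _ _).1; rewrite ?fin_num_measure//; exact/esym.
rewrite !integral_measure_add// /cintegral.
by apply: (sube_swap _ _ _ _).2; rewrite ?integrable_fin_num.
Qed.

(** Turns a moment condition, stated with the variation of a measure seen as a
    charge, into one on the measure itself. *)
Lemma measure_le_variation A : measurable A ->
  m1 A <= Defs.variation (charge_of_finite_measure m1) A.
Proof.
move=> mA; apply: le_trans (abse_charge_variation _ mA).
by rewrite gee0_abs.
Qed.

Lemma ge0_integral_le_variation (f : T -> \bar R) : measurable_fun [set: T] f ->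
  (forall x, 0 <= f x) ->
  \int[m1]_x f x <= \int[Defs.variation (charge_of_finite_measure m1)]_x f x.
Proof. by move=> mf f0; apply: ge0_le_measure_integral => //; exact: measure_le_variation. Qed.

End charge_difference.

(** * Resampling: two independent copies of a pair *)

Lemma integral_EFin_Rintegral (R : realType) d (T : measurableType d)
    (m : {measure set T -> \bar R}) (f : T -> R) :
  m.-integrable [set: T] (EFin \o f) ->
  (\int[m]_x (f x)%:E = (\int[m]_x f x)%:E)%E.
Proof. by move=> intf; rewrite /Rintegral fineK// integrable_fin_num. Qed.

Lemma measurable_integral_sfker (R : realType) d d' (X : measurableType d)
    (Y : measurableType d') (l : R.-sfker X ~> Y) (k : X * Y -> \bar R) :
  measurable_fun [set: X * Y] k -> measurable_fun [set: X] (fun x => \int[l x]_y k (x, y))%E.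
Proof.
move=> mk; rewrite [X in measurable_fun _ X](_ : _ =
   (fun x => \int[l x]_y k^\+ (x, y) - \int[l x]_y k^\- (x, y))%E); last first.
  apply/funext => x; rewrite integralE.
  by congr (_ - _)%E; apply: eq_integral => y _; rewrite ?funeposE ?funenegE.
apply: emeasurable_funB; apply: measurable_fun_integral_sfinite_kernel => //.
  exact: measurable_funepos.
exact: measurable_funeneg.
Qed.

Lemma measurable_integral_param (R : realType) d d' (X : measurableType d)
    (Y : measurableType d') (m : probability Y R) (k : X * Y -> \bar R) :
  measurable_fun [set: X * Y] k -> measurable_fun [set: X] (fun x => \int[m]_y k (x, y))%E.
Proof.
pose l := kprobability (@measurable_cst _ _ X (pprobability Y R) setT (m : pprobability Y R)).
exact: (@measurable_integral_sfker _ _ _ _ _ l).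
Qed.

Section resampling.
Context {R : realType} dX dY (Xs : measurableType dX) (Ys : measurableType dY).
Variable mu : probability (Xs * Ys)%type R.

Definition resample : probability ((Xs * Ys) * (Xs * Ys))%type R := (mu \x mu)%E.

Definition swap12 (w : (Xs * Ys) * (Xs * Ys)) : Xs * Ys := (w.1.1, w.2.2).
Definition swap21 (w : (Xs * Ys) * (Xs * Ys)) : Xs * Ys := (w.2.1, w.1.2).

Let measurable_swap12 : measurable_fun [set: _] swap12.
Proof. by apply: measurable_fun_pair; exact: measurableT_comp. Qed.

Let measurable_swap21 : measurable_fun [set: _] swap21.
Proof. by apply: measurable_fun_pair; exact: measurableT_comp. Qed.

HB.instance Definition _ := isMeasurableFun.Build _ _ _ _ swap12 measurable_swap12.
HB.instance Definition _ := isMeasurableFun.Build _ _ _ _ swap21 measurable_swap21.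

Lemma resample_fst A : measurable A -> resample (fst @^-1` A) = mu A.
Proof.
move=> mA; rewrite (_ : fst @^-1` A = A `*` setT); last first.
  by apply/seteqP; split => // x [].
rewrite /resample/= product_measure1E//.
by rewrite [X in (_ * X)%E](_ : _ = 1%E) ?mule1//; exact: probability_setT.
Qed.

Lemma resample_snd A : measurable A -> resample (snd @^-1` A) = mu A.
Proof.
move=> mA; rewrite (_ : snd @^-1` A = setT `*` A); last first.
  by apply/seteqP; split => // x [].
rewrite /resample/= product_measure1E//.
by rewrite [X in (X * _)%E](_ : _ = 1%E) ?mul1e//; exact: probability_setT.
Qed.

(** Crossing the coordinates of two independent copies makes them independent:
    this realizes the product of the marginals on the sample space of pairs. *)
Lemma resample_swap12 A : measurable A -> resample (swap12 @^-1` A) = marg_prod mu A.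
Proof.
move=> mA; rewrite -[LHS]/(distribution resample swap12 A).
apply/esym/product_measure_unique => // B C mB mC.
rewrite -[LHS]/(resample (swap12 @^-1` (B `*` C))).
rewrite (_ : swap12 @^-1` _ = (B `*` setT) `*` (setT `*` C)); last first.
  by apply/seteqP; split=> [[[a b] [c d]] /= []|[[a b] [c d]] /= [[? _] [_ ?]]].
rewrite /resample/= product_measure1E//; [|exact: measurableX..].
congr (mu _ * mu _)%E.
  by apply/seteqP; split=> [[x y] []|].
by apply/seteqP; split=> [[x y] []|].
Qed.

Lemma resample_swap21 A : measurable A -> resample (swap21 @^-1` A) = marg_prod mu A.
Proof.
move=> mA; rewrite -[LHS]/(distribution resample swap21 A).
apply/esym/product_measure_unique => // B C mB mC.
rewrite -[LHS]/(resample (swap21 @^-1` (B `*` C))).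
rewrite (_ : swap21 @^-1` _ = (setT `*` C) `*` (B `*` setT)); last first.
  by apply/seteqP; split=> [[[a b] [c d]] /= []|[[a b] [c d]] /= [[_ ?] [? _]]].
rewrite /resample/= product_measure1E//; [|exact: measurableX..].
rewrite muleC; congr (mu _ * mu _)%E.
  by apply/seteqP; split=> [[x y] []|].
by apply/seteqP; split=> [[x y] []|].
Qed.

(** Half the mixed difference of F over the rectangle spanned by the two sampled
    points; its integral is the integral of F against the joint law minus that
    against the product of the marginals. *)
Definition mixed (F : Xs * Ys -> R) (w : (Xs * Ys) * (Xs * Ys)) : R :=
  2^-1 * (F w.1 - F (swap12 w) - F (swap21 w) + F w.2).

Section mixed_difference.
Variable F : Xs * Ys -> R.
Hypothesis mF : measurable_fun [set: Xs * Ys] F.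
Hypothesis intF1 : mu.-integrable [set: _] (EFin \o F).
Hypothesis intF2 : (marg_prod mu).-integrable [set: _] (EFin \o F).

Let mEF : measurable_fun [set: Xs * Ys] (EFin \o F).
Proof. exact/measurable_EFinP. Qed.

Lemma integrable_fst : resample.-integrable [set: _] (EFin \o (F \o fst)).
Proof. exact: (integrable_image_law measurable_fst resample_fst mEF).1. Qed.
Lemma integrable_snd : resample.-integrable [set: _] (EFin \o (F \o snd)).
Proof. exact: (integrable_image_law measurable_snd resample_snd mEF).1. Qed.
Lemma integrable_swap12 : resample.-integrable [set: _] (EFin \o (F \o swap12)).
Proof. exact: (integrable_image_law measurable_swap12 resample_swap12 mEF).1. Qed.
Lemma integrable_swap21 : resample.-integrable [set: _] (EFin \o (F \o swap21)).
Proof. exact: (integrable_image_law measurable_swap21 resample_swap21 mEF).1. Qed.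

Lemma integrable_mixed : resample.-integrable [set: _] (EFin \o mixed F).
Proof.
have i := integrableD measurableT (integrableB measurableT
  (integrableB measurableT integrable_fst integrable_swap12) integrable_swap21) integrable_snd.
exact: (integrableZl measurableT 2^-1 i).
Qed.

Lemma Rintegral_mixed : \int[resample]_w mixed F w =
  \int[mu]_p F p - \int[marg_prod mu]_p F p.
Proof.
have i1 := integrable_fst. have i2 := integrable_snd.
have i3 := integrable_swap12. have i4 := integrable_swap21.
have i13 : resample.-integrable [set: _] (EFin \o (fun w => F w.1 - F (swap12 w))).
  exact: (integrableB measurableT i1 i3).
have i134 : resample.-integrable [set: _] (EFin \o (fun w => F w.1 - F (swap12 w) - F (swap21 w))).
  exact: (integrableB measurableT i13 i4).
rewrite RintegralZl//; last exact: (integrableD measurableT i134 i2).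
rewrite RintegralD// RintegralB// RintegralB//.
rewrite /Rintegral.
rewrite -(integral_image_law measurable_fst resample_fst mEF).
rewrite -(integral_image_law measurable_snd resample_snd mEF).
rewrite -(integral_image_law measurable_swap12 resample_swap12 mEF).
rewrite -(integral_image_law measurable_swap21 resample_swap21 mEF).
by field.
Qed.

(** A signed integral becomes an integral against one probability measure: of the
    four corners of the rectangle, two follow the joint law and two the product of
    the marginals. *)
Lemma cintegral_dependence :
  (\cint[dependence_charge mu]_p (F p)%:E = \int[resample]_w (mixed F w)%:E)%E.
Proof.
rewrite integral_EFin_Rintegral; last exact: integrable_mixed.
rewrite Rintegral_mixed EFinB -!integral_EFin_Rintegral//.
exact: cintegral_difference.
Qed.

End mixed_difference.
End resampling.

Section double_integral.
Context {R : realType} dX dY (Xs : measurableType dX) (Ys : measurableType dY).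

Definition mixed2 (a : Xs -> Xs -> R) (b : Ys -> Ys -> R)
    (w w' : (Xs * Ys) * (Xs * Ys)) : R :=
  mixed (fun q => mixed (fun p => a p.1 q.1 * b p.2 q.2) w) w'.

Definition second_difference T (a : T -> T -> R) x xt x' xt' : R :=
  a x x' - a x xt' - a xt x' + a xt xt'.

(** On products of two kernels the mixed differences factor into second
    differences, which do not see summands depending on one variable only. *)
Lemma mixed2E a b w w' : mixed2 a b w w' =
  4^-1 * second_difference a w.1.1 w.2.1 w'.1.1 w'.2.1 *
  second_difference b w.1.2 w.2.2 w'.1.2 w'.2.2.
Proof. by rewrite /mixed2 /mixed /second_difference /swap12 /swap21/=; field. Qed.

Variables (mu mu' : probability (Xs * Ys)%type R).
Variables (a : Xs -> Xs -> R) (b : Ys -> Ys -> R).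
Hypothesis ma : measurable_kernel2 a.
Hypothesis mb : measurable_kernel2 b.
Variable N : Xs * Ys -> R.
Hypothesis abN : forall p q, `|a p.1 q.1 * b p.2 q.2| <= N p * N q.
Hypothesis intN : mu.-integrable [set: _] (EFin \o N).
Hypothesis intNp : (marg_prod mu).-integrable [set: _] (EFin \o N).
Hypothesis intN' : mu'.-integrable [set: _] (EFin \o N).
Hypothesis intNp' : (marg_prod mu').-integrable [set: _] (EFin \o N).

Let F (q p : Xs * Ys) : R := a p.1 q.1 * b p.2 q.2.

Let mF : measurable_fun [set: (Xs * Ys) * (Xs * Ys)] (fun z => F z.1 z.2).
Proof.
by apply: measurable_funM; apply: measurable_kernel2_comp => //; exact: measurableT_comp.
Qed.

Let mFq q : measurable_fun [set: Xs * Ys] (F q).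
Proof. exact: (measurableT_comp mF (measurable_pair1 q)). Qed.

Let intF (m : {measure set (Xs * Ys) -> \bar R}) q :
  m.-integrable [set: _] (EFin \o N) -> m.-integrable [set: _] (EFin \o F q).
Proof.
move=> mint; apply: (@le_integrable _ _ _ _ _ measurableT _ (fun p => (N q)%:E * (N p)%:E)%E).
- exact/measurable_EFinP.
- move=> p _; rewrite -EFinM !abse_EFin lee_fin mulrC.
  by apply: le_trans (abN _ _) _; exact: ler_norm.
- exact: integrableZl.
Qed.

Let J q := \int[resample mu]_w mixed (F q) w.

Let intM q : (resample mu).-integrable [set: _] (EFin \o mixed (F q)).
Proof. by apply: integrable_mixed => //; exact: intF. Qed.

Let JE q : (\cint[dependence_charge mu]_p (F q p)%:E = (J q)%:E)%E.
Proof.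
by rewrite cintegral_dependence ?integral_EFin_Rintegral//; exact: intF.
Qed.

Let mJ : measurable_fun [set: _] J.
Proof.
apply: (measurableT_comp (f := fine)) => //.
apply: (@measurable_integral_param _ _ _ _ _ _ (fun z => (mixed (F z.1) z.2)%:E)).
apply/measurable_EFinP; apply: measurable_funM => //.
have h (c : (Xs * Ys) * (Xs * Ys) -> Xs * Ys) : measurable_fun [set: _] c ->
    measurable_fun [set: _] (fun z : (Xs * Ys) * ((Xs * Ys) * (Xs * Ys)) => F z.1 (c z.2)).
  move=> mc; apply: (measurableT_comp mF (g := fun z => (z.1, c z.2))).
  by apply: measurable_fun_pair => //; exact: measurableT_comp.
apply: measurable_funD; last exact: (h snd).
apply: measurable_funB; last exact: h.
apply: measurable_funB; last exact: h.
exact: (h fst).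
Qed.

Let J_le : exists C, forall q, `|J q| <= C * N q.
Proof.
exists (\int[mu]_p N p + \int[marg_prod mu]_p N p) => q.
rewrite /J Rintegral_mixed//; [|exact: intF..].
apply: le_trans (ler_normB _ _) _; rewrite mulrDl.
have h (m : {measure set (Xs * Ys) -> \bar R}) : m.-integrable [set: _] (EFin \o N) ->
    `|\int[m]_p F q p| <= \int[m]_p N p * N q.
  move=> mint; apply: le_trans (le_normr_Rintegral _ (intF _ mint)) _ => //.
  rewrite -RintegralZr//; apply: le_Rintegral => //.
  - exact: integrable_norm (intF _ mint).
  - by have := integrableZr measurableT (N q) mint.
  - by move=> p _; exact: abN.
by apply: lerD; exact: h.
Qed.

Let intJ (m : {measure set (Xs * Ys) -> \bar R}) :
  m.-integrable [set: _] (EFin \o N) -> m.-integrable [set: _] (EFin \o J).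
Proof.
have [C JC] := J_le.
move=> mint; apply: (@le_integrable _ _ _ _ _ measurableT _ (fun p => C%:E * (N p)%:E)%E).
- exact/measurable_EFinP.
- by move=> p _; rewrite -EFinM !abse_EFin lee_fin (le_trans (JC _))// ler_norm.
- exact: integrableZl.
Qed.

(** The representation of the inner signed integral is a function of q, measurable
    by Fubini and bounded by a multiple of N, to which the same representation
    applies. *)
Lemma double_cint_resample :
  (double_cint a b (dependence_charge mu) (dependence_charge mu') =
  \int[resample mu']_w' \int[resample mu]_w (mixed2 a b w w')%:E)%E.
Proof.
transitivity (\cint[dependence_charge mu']_q (J q)%:E)%E.
  by congr cintegral; apply/funext => q; exact: JE.
rewrite cintegral_dependence//; [|exact: intJ..].
apply: eq_integral => w' _.
have iB := integrableB measurableT (intM w'.1) (intM (swap12 w')).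
have iBB := integrableB measurableT iB (intM (swap21 w')).
have iBBD := integrableD measurableT iBB (intM w'.2).
rewrite integral_EFin_Rintegral; last exact: (integrableZl measurableT 2^-1 iBBD).
congr (_%:E).
transitivity (\int[resample mu]_w (2^-1 * (mixed (F w'.1) w - mixed (F (swap12 w')) w -
  mixed (F (swap21 w')) w + mixed (F w'.2) w))) => //.
by rewrite RintegralZl// RintegralD// RintegralB// RintegralB.
Qed.

End double_integral.

(** * Gluing a measure and a probability kernel *)

(** The sigma-algebra of the space of probabilities is the one generated by the
    evaluations at measurable sets. *)
Lemma measurable_to_pprobability (R : realType) d d' (X : measurableType d)
    (Y : measurableType d') (k : X -> pprobability Y R) :
  (forall U, measurable U -> measurable_fun [set: X] (fun x => k x U)) ->
  measurable_fun [set: X] k.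
Proof.
move=> mk; apply: (measurability (@pset _ _ _ : set (set (pprobability _ R)))) => //.
move=> _ -[_ [r r01] [U mU <-]] <-; apply: emeasurable_fun_infty_o => //=.
exact: mk.
Qed.

Lemma measure_unique_rectangles (R : realType) d d' (X : measurableType d)
    (Y : measurableType d') (m1 : probability (X * Y)%type R)
    (m2 : {measure set (X * Y) -> \bar R}) :
  (forall A B, measurable A -> measurable B -> m1 (A `*` B) = m2 (A `*` B)) ->
  forall A, measurable A -> m1 A = m2 A.
Proof.
move=> m12 A mA.
pose C : set (set (X * Y)) := [set A `*` B | A in measurable & B in measurable].
have CI : setI_closed C.
  move=> _ _ [X1 mX1 [X2 mX2 <-]] [Y1 mY1 [Y2 mY2 <-]].
  exists (X1 `&` Y1); first exact: measurableI.
  by exists (X2 `&` Y2); [exact: measurableI|rewrite setXI].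
apply: (@measure_unique _ _ _ C (fun=> setT)) => //.
- by rewrite measurable_prod_measurableType.
- by move=> _; exists setT => //; exists setT => //; rewrite setXTT.
- by rewrite bigcup_const//; exists 0%N.
- by move=> _ [U mU [V mV <-]]; exact: m12.
- by move=> _; apply: le_lt_trans (probability_le1 m1 measurableT) _; rewrite ltey.
Qed.

(** The law on Zs * W whose first marginal is mu and whose conditional laws are the
    k z, with its Fubini theorem. *)
Section graph_kernel.
Context {R : realType} dZ dW (Zs : measurableType dZ) (W : measurableType dW).
Variable k : Zs -> pprobability W R.
Hypothesis mk : measurable_fun [set: Zs] k.

Definition pair_at (z : Zs) (w : W) : Zs * W := (z, w).

Let measurable_pair_at z : measurable_fun [set: W] (pair_at z).
Proof. exact: measurable_pair1. Qed.

HB.instance Definition _ z := isMeasurableFun.Build _ _ _ _ (pair_at z) (measurable_pair_at z).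

Definition graph_law (z : Zs) : probability (Zs * W)%type R := distribution (k z) (pair_at z).

Let measurable_graph_law : measurable_fun [set: (unit * Zs)%type]
  (graph_law \o snd : unit * Zs -> pprobability (Zs * W)%type R).
Proof.
apply: measurable_to_pprobability => U mU.
rewrite (_ : (fun p => _) = (fun z => kprobability mk z (xsection U z)) \o snd).
  apply: measurableT_comp => //.
  by apply: measurable_fun_xsection_finite_kernel; rewrite inE.
by apply/funext => p; rewrite /= xsectionE.
Qed.

Variable mu : probability Zs R.

(* the kernel calculus composes kernels, hence the one-point source *)
Definition semidirect : set (Zs * W) -> \bar R :=
  kcomp (kprobability (@measurable_cst _ _ unit (pprobability Zs R) setT (mu : pprobability Zs R)))
    (kprobability measurable_graph_law) tt.

HB.instance Definition _ := Measure.on semidirect.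

Let semidirect_setT : (semidirect setT = 1)%E.
Proof.
rewrite /semidirect /kcomp -[RHS](probability_setT mu) -[in RHS](setTI setT).
rewrite -[RHS]integral_indic//; apply: eq_integral => z _.
by rewrite indicT; exact: probability_setT.
Qed.

HB.instance Definition _ := Measure_isProbability.Build _ _ _ semidirect semidirect_setT.

Local Open Scope ereal_scope.

Lemma ge0_integral_semidirect (f : Zs * W -> \bar R) :
  measurable_fun [set: Zs * W] f -> (forall x, 0 <= f x) ->
  \int[semidirect]_x f x = \int[mu]_z \int[k z]_w f (z, w).
Proof.
move=> mf f0; rewrite /semidirect integral_kcomp//.
apply: eq_integral => z _.
by rewrite [LHS](@ge0_integral_distribution _ _ _ _ _ (k z) (pair_at z)).
Qed.

Lemma measurable_integral_pprobability (f : Zs * W -> \bar R) :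
  measurable_fun [set: Zs * W] f ->
  measurable_fun [set: Zs] (fun z => \int[k z]_w f (z, w)).
Proof. exact: (@measurable_integral_sfker R _ _ _ _ (kprobability mk) f). Qed.

Lemma integrable_semidirectP (f : Zs * W -> \bar R) :
  measurable_fun [set: Zs * W] f ->
  semidirect.-integrable [set: Zs * W] f <-> \int[mu]_z \int[k z]_w `|f (z, w)| < +oo.
Proof.
move=> mf; have maf : measurable_fun [set: Zs * W] (abse \o f) by exact: measurableT_comp.
rewrite -(@ge0_integral_semidirect (abse \o f))//; last by move=> x; exact: abse_ge0.
by split => [/integrableP[]//|foo]; apply/integrableP.
Qed.

Lemma integrable_integral_semidirect (f : Zs * W -> \bar R) :
  semidirect.-integrable [set: Zs * W] f ->
  mu.-integrable [set: Zs] (fun z => \int[k z]_w f (z, w)).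
Proof.
move=> intf; have mf := measurable_int _ intf.
apply/integrableP; split; first exact: measurable_integral_pprobability.
apply: le_lt_trans ((integrable_semidirectP mf).1 intf).
apply: ge0_le_integral => //.
- by apply: measurableT_comp => //; exact: measurable_integral_pprobability.
- by apply: (measurable_integral_pprobability (f := abse \o f)); exact: measurableT_comp.
- move=> z _; apply: le_abse_integral => //.
  exact: (measurableT_comp mf (measurable_pair1 z)).
Qed.

Lemma integral_semidirect (f : Zs * W -> \bar R) :
  semidirect.-integrable [set: Zs * W] f ->
  \int[semidirect]_x f x = \int[mu]_z \int[k z]_w f (z, w).
Proof.
move=> intf; have mf := measurable_int _ intf.
have mfp := measurable_funepos mf; have mfn := measurable_funeneg mf.
rewrite integralE !ge0_integral_semidirect// -integralB//; last 2 first.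
- by apply: integrable_integral_semidirect; exact: integrable_funepos.
- by apply: integrable_integral_semidirect; exact: integrable_funeneg.
apply: eq_integral => z _; rewrite [RHS]integralE.
by congr (_ - _); apply: eq_integral => w _; rewrite ?funeposE ?funenegE.
Qed.

End graph_kernel.

Section resample_kernel.
Context {R : realType} dX dY dZ (Xs : measurableType dX) (Ys : measurableType dY)
  (Zs : measurableType dZ).
Variables (K : Zs -> pprobability (Xs * Ys)%type R) (mK : measurable_fun [set: Zs] K).

Lemma measurable_resample : measurable_fun [set: Zs]
  (fun z => resample (K z) : pprobability ((Xs * Ys) * (Xs * Ys))%type R).
Proof.
apply: measurable_to_pprobability => U mU.
have mK1 : measurable_fun [set: (Zs * (Xs * Ys))%type] (K \o fst).
  exact: measurableT_comp.
pose U' : set ((Zs * (Xs * Ys)) * (Xs * Ys)) := (fun q => (q.1.2, q.2)) @^-1` U.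
have mU' : measurable U'.
  rewrite -[X in measurable X]setTI.
  have : measurable_fun [set: ((Zs * (Xs * Ys)) * (Xs * Ys))%type] (fun q => (q.1.2, q.2)).
    by apply: measurable_fun_pair => //; exact: measurableT_comp.
  exact.
apply: (@measurable_integral_sfker R _ _ _ _ (kprobability mK) (fun q => kprobability mK1 q (xsection U' q))).
by apply: measurable_fun_xsection_finite_kernel; rewrite inE.
Qed.

End resample_kernel.

(** A conditional law prescribes the probabilities of rectangles, and those
    determine the joint law. *)
Lemma cond_law_semidirect (R : realType) dO dT dZ (Omega : measurableType dO)
    (T : measurableType dT) (Zs : measurableType dZ) (P : probability Omega R)
    (W : {RV P >-> T}) (Z : {RV P >-> Zs}) (K : Zs -> pprobability T R)
    (mK : measurable_fun [set: Zs] K) :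
  cond_law W Z K -> forall A, measurable A ->
  P ((fun o => (Z o, W o)) @^-1` A) = semidirect mK (distribution P Z) A.
Proof.
move=> [_ KP].
have mphi : measurable_fun [set: Omega] (fun o => (Z o, W o)).
  by apply: measurable_fun_pair.
pose phi_mixin := isMeasurableFun.Build _ _ _ _ _ mphi.
pose phi : {mfun Omega >-> (Zs * T)%type} := HB.pack (fun o => (Z o, W o)) phi_mixin.
move=> A mA; rewrite -[LHS]/(distribution P phi A).
apply: measure_unique_rectangles => // B C mB mC.
transitivity (P (W @^-1` C `&` Z @^-1` B)); first by rewrite setIC.
rewrite KP// -[B `*` C]setIT -integral_indic//; last exact: measurableX.
rewrite ge0_integral_semidirect; last 2 first.
- by apply/measurable_EFinP; apply: measurable_indic; exact: measurableX.
- by move=> x; rewrite lee_fin.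
rewrite integral_mkcond; apply: eq_integral => z _; rewrite patchE.
have -> : (\int[K z]_w (\1_(B `*` C) (z, w))%:E = \int[K z]_w ((\1_B z)%:E * (\1_C w)%:E))%E.
  by apply: eq_integral => w _; rewrite -EFinM !indicE in_setX -natrM mulnb.
rewrite integralZl//; last exact: integrable_indic.
rewrite integral_indic// setIT indicE.
by case: (z \in B); rewrite ?mul1e ?mul0e.
Qed.

(** * Null sets and the symmetric covariance formula *)

Section integral_null.
Local Open Scope ereal_scope.
Context {R : realType} d (T : measurableType d) (mu : {measure set T -> \bar R}).
Import HBNNSimple.

(** The integral of a nonnegative function, measurable or not, is a supremum over
    the simple functions below it, and cutting such a function off on N does not
    change its integral. This serves for integrands that are controlled only
    outside of a null set. *)
Lemma ge0_le_integral_null (N : set T) (f g : T -> \bar R) :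
  measurable N -> mu N = 0 -> (forall x, 0 <= f x) -> (forall x, 0 <= g x) ->
  (forall x, ~ N x -> f x <= g x) -> \int[mu]_x f x <= \int[mu]_x g x.
Proof.
move=> mN N0 f0 g0 fg; rewrite [leLHS]ge0_integralTE//.
apply: ub_ereal_sup => _ [h hf <-].
have mCN : measurable (~` N) by exact: measurableC.
pose h' := proj_nnsfun h mCN.
have -> : sintegral mu h = sintegral mu h'.
  rewrite -!integralT_nnsfun.
  apply: ge0_ae_eq_integral => //.
  - exact/measurable_EFinP.
  - exact/measurable_EFinP.
  - by move=> x _; rewrite lee_fin.
  - by move=> x _; rewrite lee_fin.
  exists N; split => // x /= /not_implyP[_ hh]; apply: contrapT => Nx; apply: hh.
  by rewrite /h'/= mindicE mem_set ?mulr1.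
rewrite [leRHS]ge0_integralTE//; apply: ereal_sup_ubound; exists h' => // x.
rewrite /h'/= mindicE; have [xN|xN] := boolP (x \in ~` N).
  by rewrite mulr1; apply: le_trans (hf x) _; apply: fg; exact: set_mem.
by rewrite mulr0.
Qed.

Lemma eq_integral_null (N : set T) (f g : T -> \bar R) :
  mu.-negligible N -> (forall x, ~ N x -> f x = g x) ->
  \int[mu]_x f x = \int[mu]_x g x.
Proof.
move=> [A [mA A0 NA]] fg; have fgA x : ~ A x -> f x = g x by move=> nA; apply: fg => /NA.
rewrite integralE [RHS]integralE; congr (_ - _); apply/eqP; rewrite eq_le.
  by apply/andP; split; apply: (ge0_le_integral_null mA A0) => // x nA;
    rewrite !funeposE fgA.
by apply/andP; split; apply: (ge0_le_integral_null mA A0) => // x nA;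
    rewrite !funenegE fgA.
Qed.
End integral_null.

Section covariance.
Context {R : realType} dX dY (Xs : measurableType dX) (Ys : measurableType dY).
Variable mu : probability (Xs * Ys)%type R.
Variables (f : Xs -> R) (g : Ys -> R).
Hypothesis mf : measurable_fun [set: Xs] f.
Hypothesis mg : measurable_fun [set: Ys] g.
Hypothesis intf : mu.-integrable [set: _] (fun p => (f p.1)%:E).
Hypothesis intg : mu.-integrable [set: _] (fun p => (g p.2)%:E).
Hypothesis intfg : mu.-integrable [set: _] (fun p => (f p.1 * g p.2)%:E).

Let mfE : measurable_fun [set: Xs] (EFin \o f). Proof. exact/measurable_EFinP. Qed.
Let mgE : measurable_fun [set: Ys] (EFin \o g). Proof. exact/measurable_EFinP. Qed.

Let law1 A : measurable A -> mu (fst @^-1` A) = marg1 mu A. Proof. by []. Qed.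
Let law2 A : measurable A -> mu (snd @^-1` A) = marg2 mu A. Proof. by []. Qed.

Lemma expectation_marg1 : ('E_(marg1 mu)[f] = (\int[mu]_p f p.1)%:E)%E.
Proof.
rewrite unlock (integral_image_law measurable_fst law1 mfE).
exact: integral_EFin_Rintegral.
Qed.

Lemma expectation_marg2 : ('E_(marg2 mu)[g] = (\int[mu]_p g p.2)%:E)%E.
Proof.
rewrite unlock (integral_image_law measurable_snd law2 mgE).
exact: integral_EFin_Rintegral.
Qed.

Let int1 : (marg1 mu).-integrable [set: _] (EFin \o f).
Proof. exact: (integrable_image_law measurable_fst law1 mfE).2. Qed.
Let int2 : (marg2 mu).-integrable [set: _] (EFin \o g).
Proof. exact: (integrable_image_law measurable_snd law2 mgE).2. Qed.

Let mprod : measurable_fun [set: Xs * Ys] (fun p => (f p.1 * g p.2)%:E).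
Proof. by apply/measurable_EFinP/measurable_funM; exact: measurableT_comp. Qed.

Lemma integrable_marg_prod :
  (marg_prod mu).-integrable [set: Xs * Ys] (fun p => (f p.1 * g p.2)%:E).
Proof.
apply/integrable12ltyP => //.
have -> : (\int[marg1 mu]_x \int[marg2 mu]_y `|(f (x, y).1 * g (x, y).2)%:E| =
    \int[marg1 mu]_x (`|(f x)%:E| * (\int[marg2 mu]_y `|(g y)%:E|)))%E.
  apply: eq_integral => x _; rewrite -ge0_integralZl//.
    by apply: eq_integral => y _; rewrite EFinM abseM.
  exact: measurableT_comp.
have [_ foo] := integrableP _ _ _ int1; have [_ goo] := integrableP _ _ _ int2.
rewrite ge0_integralZr//; [|exact: measurableT_comp|exact: integral_ge0].
by rewrite lte_mul_pinfty ?integral_ge0// ge0_fin_numE ?integral_ge0.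
Qed.

Lemma integral_marg_prod :
  (\int[marg_prod mu]_p (f p.1 * g p.2)%:E =
   (\int[mu]_p f p.1 * \int[mu]_p g p.2)%:E)%E.
Proof.
rewrite -(integral12_prod_meas1 integrable_marg_prod) /fubini_F/=.
have E1 := integral_EFin_Rintegral intf. have E2 := integral_EFin_Rintegral intg.
transitivity (\int[marg1 mu]_x ((f x)%:E * (\int[mu]_p g p.2)%:E))%E.
  apply: eq_integral => x _; rewrite -E2 -[X in (_ * X)%E](integral_image_law measurable_snd law2 mgE).
  by rewrite -integralZl.
rewrite integralZr// EFinM -E1; congr (_ * _)%E.
exact: (integral_image_law measurable_fst law1 mfE).
Qed.

(** The classical formula Cov(U, V) = E[(U - U')(V - V')]/2 for an independent copy
    (U', V') of (U, V). *)
Theorem integral_resample_covariance :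
  (\int[resample mu]_w (2^-1 * (f w.1.1 - f w.2.1) * (g w.1.2 - g w.2.2))%:E =
   \int[mu]_p (f p.1 * g p.2)%:E - (\int[mu]_p f p.1 * \int[mu]_p g p.2)%:E)%E.
Proof.
pose F p := f p.1 * g p.2.
have mF : measurable_fun [set: Xs * Ys] F by apply/measurable_EFinP.
transitivity (\int[resample mu]_w (mixed F w)%:E)%E.
  by apply: eq_integral => w _; congr (_%:E); rewrite /mixed /F/=; ring.
rewrite -integral_marg_prod -cintegral_dependence//; last exact: integrable_marg_prod.
by rewrite cintegral_difference//; exact: integrable_marg_prod.
Qed.

End covariance.

(** * Conditional expectations computed from a conditional law *)

Section conditioning_kernel.
Context {R : realType} dO dT dZ (Omega : measurableType dO)
    (T : measurableType dT) (Zs : measurableType dZ) (P : probability Omega R)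
    (W : {RV P >-> T}) (Z : {RV P >-> Zs}) (K : Zs -> pprobability T R)
    (mK : measurable_fun [set: Zs] K) (WZK : cond_law W Z K).
Local Open Scope ereal_scope.

Let PZ : probability Zs R := distribution P Z.

Let mZ : measurable_fun [set: Omega] Z. Proof. exact: measurable_funP. Qed.

Let mZW : measurable_fun [set: Omega] (fun o => (Z o, W o)).
Proof. exact: measurable_fun_pair. Qed.

Let law := cond_law_semidirect mK WZK.

Lemma integral_joint_law (phi : Zs * T -> \bar R) : measurable_fun [set: _] phi ->
  \int[semidirect mK PZ]_x phi x = \int[P]_o phi (Z o, W o).
Proof. by move=> mphi; rewrite (integral_image_law mZW law). Qed.

Lemma integrable_joint_law (phi : Zs * T -> \bar R) : measurable_fun [set: _] phi ->
  (semidirect mK PZ).-integrable [set: _] phi <->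
  P.-integrable [set: Omega] (fun o => phi (Z o, W o)).
Proof. by move=> mphi; rewrite (integrable_image_law mZW law). Qed.

Section kernel_mean.
Variable phi : Zs * T -> R.
Hypothesis mphi : measurable_fun [set: Zs * T] phi.
Hypothesis intphi : P.-integrable [set: Omega] (fun o => (phi (Z o, W o))%:E).

Let mEphi : measurable_fun [set: Zs * T] (EFin \o phi).
Proof. exact/measurable_EFinP. Qed.

Let intE : (semidirect mK PZ).-integrable [set: _] (EFin \o phi).
Proof. exact/integrable_joint_law. Qed.

Definition kernel_mean (z : Zs) : R := (\int[K z]_p phi (z, p))%R.

Lemma measurable_kernel_mean : measurable_fun [set: Zs] kernel_mean.
Proof.
apply: (measurableT_comp (f := fine)) => //.
exact: (measurable_integral_pprobability mK mEphi).
Qed.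

Lemma integrable_kernel_abs : PZ.-integrable [set: Zs] (fun z => \int[K z]_p `|(phi (z, p))%:E|).
Proof.
apply/integrableP; split.
  by apply: (measurable_integral_pprobability mK (f := abse \o (EFin \o phi))); exact: measurableT_comp.
have := (integrable_semidirectP mK PZ mEphi).1 intE.
apply: le_lt_trans; rewrite le_eqVlt; apply/orP; left; apply/eqP.
by apply: eq_integral => z _; rewrite [LHS]gee0_abs ?integral_ge0.
Qed.

Lemma ae_integrable_kernel :
  {ae PZ, forall z, (K z).-integrable [set: T] (fun p => (phi (z, p))%:E)}.
Proof.
have /(integrable_ae measurableT) := integrable_kernel_abs.
apply: filterS => z /(_ I) hz; apply/integrableP; split.
  exact: (measurableT_comp mEphi (measurable_pair1 z)).
by rewrite ltey_eq hz.
Qed.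

Lemma integrable_kernel_mean : PZ.-integrable [set: Zs] (EFin \o kernel_mean).
Proof.
apply: (le_integrable measurableT _ _ integrable_kernel_abs).
  exact/measurable_EFinP/measurable_kernel_mean.
move=> z _; rewrite /= [leRHS]gee0_abs ?integral_ge0//.
apply: (@le_trans _ _ `|\int[K z]_p (phi (z, p))%:E|).
  by rewrite /kernel_mean /Rintegral; case: (\int[K z]_p _) => [r| |]//=; rewrite ?normr0 ?lee_fin// leey.
apply: le_abse_integral => //.
exact: (measurableT_comp mEphi (measurable_pair1 z)).
Qed.

Lemma integral_kernel_mean : \int[PZ]_z (kernel_mean z)%:E = \int[P]_o (phi (Z o, W o))%:E.
Proof.
rewrite -(integral_joint_law mEphi) integral_semidirect//.
apply: (eq_integral_null (N := ~` [set z | (K z).-integrable [set: T] (fun p => (phi (z, p))%:E)])).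
  exact: ae_integrable_kernel.
by move=> z /contrapT hz; rewrite -integral_EFin_Rintegral.
Qed.

End kernel_mean.

(** Integrating phi against the kernel gives a version of the conditional
    expectation. It is everywhere finite, as a version must be, because the real
    integral takes the value 0 where phi fails to be integrable. *)
Lemma cond_expectation_kernel_mean (phi : Zs * T -> R) :
  measurable_fun [set: Zs * T] phi ->
  P.-integrable [set: Omega] (fun o => (phi (Z o, W o))%:E) ->
  cond_expectation (fun o => phi (Z o, W o)) Z (kernel_mean phi).
Proof.
move=> mphi intphi.
have mu := measurable_kernel_mean mphi.
have muE : measurable_fun [set: Zs] (EFin \o kernel_mean phi) by exact/measurable_EFinP.
have intu := integrable_kernel_mean mphi intphi.
have lawZ A : measurable A -> P (Z @^-1` A) = PZ A by [].
have intuZ : P.-integrable [set: Omega] (EFin \o (kernel_mean phi \o Z)).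
  exact: ((integrable_image_law mZ lawZ muE).1 intu).
split => // B mB.
have mZB : measurable (Z @^-1` B) by rewrite -[X in measurable X]setTI; exact: measurable_funP.
rewrite integral_mkcond [RHS]integral_mkcond.
pose psi (x : Zs * T) : R := (\1_B x.1 * phi x)%R.
have mpsi : measurable_fun [set: Zs * T] psi.
  by apply: measurable_funM => //; apply: measurableT_comp => //; exact: measurable_indic.
have psiE o : (psi (Z o, W o))%:E = ((fun o => (phi (Z o, W o))%:E) \_ (Z @^-1` B)) o.
  rewrite /psi patchE indicE/=.
  have -> : (o \in Z @^-1` B) = (Z o \in B) by apply/idP/idP; rewrite !inE.
  by case: (Z o \in B); rewrite ?mul1r ?mul0r.
have intpsi : P.-integrable [set: Omega] (fun o => (psi (Z o, W o))%:E).
  under eq_fun do rewrite psiE.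
  exact: ((integrable_mkcond _ mZB).1 (integrableS measurableT mZB (@subsetT _ _) intphi)).
have := integral_kernel_mean mpsi intpsi.
under [X in _ = X -> _]eq_integral do rewrite psiE.
move=> <-.
pose ub z : \bar R := (kernel_mean psi z)%:E.
have mub : measurable_fun [set: Zs] ub by apply/measurable_EFinP/measurable_kernel_mean.
rewrite -[RHS]/(\int[PZ]_z ub z) (integral_image_law mZ lawZ mub).
apply: eq_integral => o _; rewrite patchE /ub /kernel_mean /psi/=.
have -> : (o \in Z @^-1` B) = (Z o \in B) by apply/idP/idP; rewrite !inE.
rewrite indicE; case: (Z o \in B) => /=.
  by congr (_%:E); apply: eq_Rintegral => p _; rewrite mul1r.
rewrite /Rintegral; under eq_integral do rewrite mul0r.
by rewrite integral0.
Qed.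

End conditioning_kernel.

(** * Kernel features and their integrable bound *)

Section second_moments.
Context {R : realType} dX dY (Xs : measurableType dX) (Ys : measurableType dY)
  (kX : Xs -> Xs -> R) (kY : Ys -> Ys -> R) (HX : rkhs kX) (HY : rkhs kY).
Hypothesis kX_meas : measurable_kernel2 kX.
Hypothesis kY_meas : measurable_kernel2 kY.

Local Notation sX := (kernel_section HX).
Local Notation sY := (kernel_section HY).

(** One function that dominates kX(x, x)^2, kY(y, y)^2, the products
    sqrt(kX(x, x) kY(y, y)) and, by the constant 2, all lower powers; it is a sum of
    a function of x and a function of y, so that it has the same integral against a
    law and against the product of its marginals. *)
Definition moment_bound (p : Xs * Ys) : R := 2 + kX p.1 p.1 ^+ 2 + kY p.2 p.2 ^+ 2.

Lemma momentE p : moment_bound p = 2 + `|sX p.1| ^+ 4 + `|sY p.2| ^+ 4.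
Proof. by rewrite /moment_bound -(norm_kernel_section HX) -(norm_kernel_section HY) -!exprM. Qed.

Lemma moment_ge2 p : 2 <= moment_bound p.
Proof. by rewrite /moment_bound -addrA lerDl addr_ge0// sqr_ge0. Qed.

Lemma measurable_moment : measurable_fun [set: Xs * Ys] moment_bound.
Proof.
apply: measurable_funD; first apply: measurable_funD => //.
  by apply: measurable_funX; apply: measurable_kernel2_comp => //; exact: measurableT_comp.
by apply: measurable_funX; apply: measurable_kernel2_comp => //; exact: measurableT_comp.
Qed.

Lemma le_add_pow4 (t s : R) : t * s <= 2 + t ^+ 4 + s ^+ 4.
Proof.
have := sqr_ge0 (t - s); have := sqr_ge0 (t ^+ 2 - 1); have := sqr_ge0 (s ^+ 2 - 1).
have := sqr_ge0 (t ^+ 2); have := sqr_ge0 (s ^+ 2); lra.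
Qed.

Lemma le_add1_pow4 (t s : R) : t <= 2 + t ^+ 4 + s ^+ 4.
Proof.
have := sqr_ge0 (t - 1); have := sqr_ge0 (t ^+ 2 - 1); have := sqr_ge0 (s ^+ 2).
have := sqr_ge0 (t ^+ 2); lra.
Qed.

Lemma norm_rkhs_fun_le (T : Type) (k : T -> T -> R) (H : rkhs k) (f : H) x :
  `|rkhs_fun f x| <= `|f| * `|kernel_section H x|.
Proof. by rewrite -hdot_kernel_section hdot_cauchy_schwarz. Qed.

Lemma norm_kernel_le (T : Type) (k : T -> T -> R) (H : rkhs k) x x' :
  `|k x x'| <= `|kernel_section H x| * `|kernel_section H x'|.
Proof. by rewrite -(hdot_kernel_sections H) hdot_cauchy_schwarz. Qed.

Lemma sections_le_moment p : `|sX p.1| * `|sY p.2| <= moment_bound p.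
Proof. by rewrite momentE; exact: le_add_pow4. Qed.

Lemma kernels_le_moment p q : `|kX p.1 q.1 * kY p.2 q.2| <= moment_bound p * moment_bound q.
Proof.
rewrite normrM; apply: (@le_trans _ _ ((`|sX p.1| * `|sX q.1|) * (`|sY p.2| * `|sY q.2|))).
  by rewrite ler_pM// norm_kernel_le.
by rewrite mulrACA ler_pM ?mulr_ge0// sections_le_moment.
Qed.

Local Notation W := ((Xs * Ys) * (Xs * Ys))%type.

(** The cross-covariance operator is the expectation of
    featY (x) featX over two independent copies; the factor 1/2 of the covariance
    formula is carried by featY. *)
Definition featX (w : W) : HX := sX w.1.1 - sX w.2.1.
Definition featY (w : W) : HY := 2^-1 *: (sY w.1.2 - sY w.2.2).
Definition feat_bound (w : W) : R := moment_bound w.1 + moment_bound w.2.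

Lemma hdot_featX f w : hdot f (featX w) = rkhs_fun f w.1.1 - rkhs_fun f w.2.1.
Proof. by rewrite hdotBr !hdot_kernel_section. Qed.

Lemma hdot_featY g w : hdot g (featY w) = 2^-1 * (rkhs_fun g w.1.2 - rkhs_fun g w.2.2).
Proof. by rewrite hdotZr hdotBr !hdot_kernel_section. Qed.

Lemma measurable_featX f : measurable_fun [set: W] (fun w => hdot f (featX w)).
Proof.
under eq_fun do rewrite hdot_featX.
have mf := measurable_rkhs_fun f kX_meas.
by apply: measurable_funB; apply: (measurableT_comp mf); exact: measurableT_comp.
Qed.

Lemma measurable_featY g : measurable_fun [set: W] (fun w => hdot g (featY w)).
Proof.
under eq_fun do rewrite hdot_featY.
have mg := measurable_rkhs_fun g kY_meas.
by apply: measurable_funM => //; apply: measurable_funB;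
  apply: (measurableT_comp mg); exact: measurableT_comp.
Qed.

Lemma measurable_feat_bound : measurable_fun [set: W] feat_bound.
Proof. by apply: measurable_funD; apply: (measurableT_comp measurable_moment). Qed.

Lemma norm_featY_le w : `|featY w| <= 2^-1 * (`|sY w.1.2| + `|sY w.2.2|).
Proof. by rewrite normrZ ger0_norm// ler_wpM2l// ler_normB. Qed.

Lemma feat_product_le (t tt s st : R) :
  (t + tt) ^+ 2 * (2^-1 * (s + st)) ^+ 2 <= (2 + t ^+ 4 + s ^+ 4) + (2 + tt ^+ 4 + st ^+ 4).
Proof.
have h (a b : R) : (a + b) ^+ 2 <= 2 * (a ^+ 2 + b ^+ 2).
  by have := sqr_ge0 (a - b); rewrite sqrrB sqrrD; lra.
apply: (@le_trans _ _ ((2 * (t ^+ 2 + tt ^+ 2)) * (2^-1 * (s ^+ 2 + st ^+ 2)))).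
  apply: ler_pM => //; rewrite ?sqr_ge0 ?exprMn//.
  by have := h s st; lra.
have := sqr_ge0 ((t ^+ 2 + tt ^+ 2) - (s ^+ 2 + st ^+ 2)).
have := h (t ^+ 2) (tt ^+ 2). have := h (s ^+ 2) (st ^+ 2).
lra.
Qed.

(** The square is bounded, not just the product: in the presence of the third
    kernel the product is multiplied by sqrt(kZ(z, z)), and
    sqrt(kZ) q <= kZ + q^2. *)
Lemma feat_sqr_le w : (`|featX w| * `|featY w|) ^+ 2 <= feat_bound w.
Proof.
rewrite /feat_bound !momentE exprMn.
apply: le_trans (feat_product_le `|sX w.1.1| `|sX w.2.1| `|sY w.1.2| `|sY w.2.2|).
apply: ler_pM; rewrite ?sqr_ge0// ler_sqr ?nnegrE ?mulr_ge0 ?addr_ge0//.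
  exact: ler_normB.
exact: norm_featY_le.
Qed.

Lemma feat_le w : `|featX w| * `|featY w| <= feat_bound w.
Proof.
have := feat_sqr_le w; have := sqr_ge0 (`|featX w| * `|featY w| - 1).
have : 4 <= feat_bound w.
  by rewrite /feat_bound; have := moment_ge2 w.1; have := moment_ge2 w.2; lra.
by move: (_ * _) => q; lra.
Qed.

Lemma hdot_feat w w' :
  hdot (featX w') (featX w) * hdot (featY w') (featY w) = mixed2 kX kY w w'.
Proof.
rewrite mixed2E /second_difference hdotZl hdotZr !hdotBl !hdotBr !hdot_kernel_sections.
have sy (T : Type) (k : T -> T -> R) (H : rkhs k) x x' : k x x' = k x' x.
  by rewrite -!(hdot_kernel_sections H) hdotC.
rewrite [kX w'.1.1 _](sy _ _ HX) [kX w'.2.1 _](sy _ _ HX) [kX w'.1.1 _](sy _ _ HX) [kX w'.2.1 _](sy _ _ HX).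
rewrite [kY w'.1.2 _](sy _ _ HY) [kY w'.2.2 _](sy _ _ HY) [kY w'.1.2 _](sy _ _ HY) [kY w'.2.2 _](sy _ _ HY).
by field.
Qed.
End second_moments.

(** * Operators and double integrals at fixed conditioning values *)

Section law_with_moments.
Context {R : realType} dX dY (Xs : measurableType dX) (Ys : measurableType dY)
  (kX : Xs -> Xs -> R) (kY : Ys -> Ys -> R) (HX : rkhs kX) (HY : rkhs kY).
Hypothesis kX_meas : measurable_kernel2 kX.
Hypothesis kY_meas : measurable_kernel2 kY.
Variable mu : probability (Xs * Ys)%type R.
Hypothesis mu_moment : mu.-integrable [set: Xs * Ys] (EFin \o moment_bound kX kY).

Let mmoment := measurable_moment kX_meas kY_meas.
Let mEmoment : measurable_fun [set: Xs * Ys] (EFin \o moment_bound kX kY).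
Proof. exact/measurable_EFinP. Qed.

Lemma integrable_feat_bound :
  (resample mu).-integrable [set: _] (EFin \o feat_bound kX kY).
Proof.
exact: (integrableD measurableT (integrable_fst mmoment mu_moment) (integrable_snd mmoment mu_moment)).
Qed.

Lemma integrable_moment_marg_prod :
  (marg_prod mu).-integrable [set: _] (EFin \o moment_bound kX kY).
Proof.
have mswap : measurable_fun [set: _] (@swap12 _ _ Xs Ys) by exact: measurable_funP.
apply: (integrable_image_law mswap (@resample_swap12 _ _ _ _ _ mu) mEmoment).2.
apply: (le_integrable measurableT _ _ integrable_feat_bound).
  exact: (measurableT_comp mEmoment mswap).
move=> w _; rewrite /= lee_fin [leRHS]ger0_norm; last first.
  by rewrite addr_ge0// (le_trans _ (moment_ge2 _ _ _)).
rewrite ger0_norm; last by rewrite (le_trans _ (moment_ge2 _ _ _)).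
rewrite /feat_bound /moment_bound /swap12/=.
have := sqr_ge0 (kX w.2.1 w.2.1); have := sqr_ge0 (kY w.1.2 w.1.2); lra.
Qed.

Lemma le_moment_integrable (phi : Xs * Ys -> R) (C : R) :
  measurable_fun [set: _] phi -> (forall p, `|phi p| <= C * moment_bound kX kY p) ->
  mu.-integrable [set: _] (EFin \o phi).
Proof.
move=> mphi phiC.
apply: (le_integrable measurableT _ _ (integrableZl measurableT C mu_moment)).
  exact/measurable_EFinP.
move=> p _; rewrite -EFinM !abse_EFin lee_fin.
by apply: le_trans (phiC p) _; exact: ler_norm.
Qed.

Section dominated_by_section.
Variables (f : Xs -> R) (C : R) (g : HY).
Hypothesis C0 : 0 <= C.
Hypothesis mf : measurable_fun [set: Xs] f.
Hypothesis fC : forall x, `|f x| <= C * `|kernel_section HX x|.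

Let mg := measurable_rkhs_fun g kY_meas.
Let mf1 : measurable_fun [set: Xs * Ys] (fun p => f p.1).
Proof. exact: measurableT_comp. Qed.
Let mg2 : measurable_fun [set: Xs * Ys] (fun p => rkhs_fun g p.2).
Proof. exact: measurableT_comp. Qed.

Lemma integrable_comp_fst : mu.-integrable [set: Xs * Ys] (fun p => (f p.1)%:E).
Proof.
apply: (le_moment_integrable (C := C)) => // p; apply: le_trans (fC _) _.
by rewrite ler_wpM2l// (momentE HX HY); exact: le_add1_pow4.
Qed.

Lemma integrable_rkhs_snd : mu.-integrable [set: Xs * Ys] (fun p => (rkhs_fun g p.2)%:E).
Proof.
apply: (le_moment_integrable (C := `|g|)) => // p; apply: le_trans (norm_rkhs_fun_le _ _) _.
by rewrite ler_wpM2l// (momentE HX HY) addrAC; exact: le_add1_pow4.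
Qed.

Lemma integrable_mul_rkhs : mu.-integrable [set: Xs * Ys] (fun p => (f p.1 * rkhs_fun g p.2)%:E).
Proof.
apply: (le_moment_integrable (C := C * `|g|)); first exact: measurable_funM.
move=> p; rewrite normrM.
apply: (@le_trans _ _ ((C * `|kernel_section HX p.1|) * (`|g| * `|kernel_section HY p.2|))).
  by apply: ler_pM => //; exact: norm_rkhs_fun_le.
by rewrite mulrACA ler_wpM2l ?mulr_ge0// sections_le_moment.
Qed.

Lemma integral_feat_covariance :
  (\int[resample mu]_w ((f w.1.1 - f w.2.1) * hdot g (featY HY w))%:E =
   \int[mu]_p (f p.1 * rkhs_fun g p.2)%:E -
   (\int[mu]_p f p.1 * \int[mu]_p rkhs_fun g p.2)%:E)%E.
Proof.
rewrite -(integral_resample_covariance mf mg integrable_comp_fst integrable_rkhs_snd integrable_mul_rkhs).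
by apply: eq_integral => w _; congr (_%:E); rewrite hdot_featY; ring.
Qed.

End dominated_by_section.

(** This is the covariance formula applied to f(X) and g(Y). *)
Lemma cross_cov_feature_op (S : HX -> HY) : is_cross_cov mu S ->
  feature_op (featX HX) (featY HY) (resample mu) S.
Proof.
move=> muS f g; rewrite muS.
have mf := measurable_rkhs_fun f kX_meas; have mg := measurable_rkhs_fun g kY_meas.
have fle := norm_rkhs_fun_le f.
under [RHS]eq_integral do rewrite hdot_featX.
rewrite (integral_feat_covariance g (normr_ge0 f) mf fle).
rewrite (expectation_marg1 mf (integrable_comp_fst (normr_ge0 f) mf fle)).
rewrite (expectation_marg2 mg (integrable_rkhs_snd g)).
by rewrite unlock EFinM.
Qed.

End law_with_moments.

Section hs_dot_cross_covariances.
Context {R : realType} dX dY (Xs : measurableType dX) (Ys : measurableType dY)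
  (kX : Xs -> Xs -> R) (kY : Ys -> Ys -> R) (HX : rkhs kX) (HY : rkhs kY).
Hypothesis kX_meas : measurable_kernel2 kX.
Hypothesis kY_meas : measurable_kernel2 kY.
Variables mu mu' : probability (Xs * Ys)%type R.
Hypothesis mu_moment : mu.-integrable [set: Xs * Ys] (EFin \o moment_bound kX kY).
Hypothesis mu'_moment : mu'.-integrable [set: Xs * Ys] (EFin \o moment_bound kX kY).

Lemma double_cint_kernels :
  (double_cint kX kY (dependence_charge mu) (dependence_charge mu') =
   \int[resample mu']_w' \int[resample mu]_w (mixed2 kX kY w w')%:E)%E.
Proof.
apply: (double_cint_resample kX_meas kY_meas (kernels_le_moment HX HY)) => //.
- exact: integrable_moment_marg_prod.
- exact: integrable_moment_marg_prod.
Qed.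

Lemma hs_dot_cross_cov (E : set HX) (S S' : {linear HX -> HY}) :
  orthonormal_basis E -> bounded_op S -> bounded_op S' ->
  is_cross_cov mu S -> is_cross_cov mu' S' ->
  (hs_dot E S S' = double_cint kX kY (dependence_charge mu) (dependence_charge mu'))%E.
Proof.
move=> E_onb Sb Sb' muS muS'; rewrite double_cint_kernels.
rewrite (hs_dot_feature_op (measurable_featX kX_meas) (measurable_featY kY_meas)
  (feat_le HX HY) E_onb _ _ Sb Sb' (m := resample mu) (m' := resample mu')).
- by apply: eq_integral => w' _; apply: eq_integral => w _; rewrite hdot_feat.
- exact: integrable_feat_bound.
- exact: integrable_feat_bound.
- exact: cross_cov_feature_op.
- exact: cross_cov_feature_op.
Qed.

(** The representation by second differences makes the two integrands equal at
    every point: the second difference of a distance-induced kernel is minus that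
    of the semimetric, and the two signs cancel. It remains to dominate the
    semimetrics, which is possible since rho(x, x') is half the squared norm of the
    difference of two kernel sections. *)
Lemma double_cint_distance (rhoX : Xs -> Xs -> R) (rhoY : Ys -> Ys -> R) theta theta' :
  semimetric rhoX -> semimetric rhoY ->
  distance_induced rhoX theta kX -> distance_induced rhoY theta' kY ->
  double_cint kX kY (dependence_charge mu) (dependence_charge mu') =
  double_cint rhoX rhoY (dependence_charge mu) (dependence_charge mu').
Proof.
move=> smX smY dX' dY'.
have rhoE (T : Type) (rho : T -> T -> R) k th : semimetric rho -> distance_induced rho th k ->
    forall x x', rho x x' = 2^-1 * k x x + 2^-1 * k x' x' - k x x'.
  move=> [_ r0 _] dk x x'; rewrite !dk.
  by rewrite (r0 x x).2// (r0 x' x').2//; lra.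
have rho_meas d (T : measurableType d) (rho : T -> T -> R) k th :
    semimetric rho -> distance_induced rho th k -> measurable_kernel2 k -> measurable_kernel2 rho.
  move=> sm dk mk.
  rewrite /measurable_kernel2 (_ : (fun p => _) =
    (fun p => 2^-1 * k p.1 p.1 + 2^-1 * k p.2 p.2 - k p.1 p.2)); last first.
    by apply/funext => p; exact: rhoE.
  by apply: measurable_funB; [apply: measurable_funD; apply: measurable_funM => //|];
    apply: measurable_kernel2_comp.
have rho_le (T : Type) (rho : T -> T -> R) k (H : rkhs k) th : semimetric rho -> distance_induced rho th k ->
    forall x x', `|rho x x'| <= k x x + k x' x'.
  move=> sm dk x x'; rewrite (rhoE _ _ _ _ sm dk).
  rewrite -!(norm_kernel_section H) -(hdot_kernel_sections H).
  set u := kernel_section H x; set v := kernel_section H x'.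
  have := sqr_ge0 `|u - v|; have := sqr_ge0 `|u + v|; rewrite normB_sqr.
  have -> : `|u + v| ^+ 2 = `|u| ^+ 2 + 2 * hdot u v + `|v| ^+ 2.
    by rewrite -!hdot_norm !hdotDl !hdotDr (hdotC v u); lra.
  by rewrite ler_norml => h1 h2; apply/andP; split; lra.
have mX := rho_meas _ _ _ _ _ smX dX' kX_meas.
have mY := rho_meas _ _ _ _ _ smY dY' kY_meas.
have rho_moment p q : `|rhoX p.1 q.1 * rhoY p.2 q.2| <= moment_bound kX kY p * moment_bound kX kY q.
  rewrite normrM.
  have := rho_le _ _ _ HX _ smX dX' p.1 q.1. have := rho_le _ _ _ HY _ smY dY' p.2 q.2.
  move=> hY hX; apply: le_trans (ler_pM _ _ hX hY) _ => //.
  rewrite /moment_bound.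
  have := rkhs_kernel_ge0 HX p.1; have := rkhs_kernel_ge0 HX q.1.
  have := rkhs_kernel_ge0 HY p.2; have := rkhs_kernel_ge0 HY q.2.
  move: (kX p.1 p.1) (kX q.1 q.1) (kY p.2 p.2) (kY q.2 q.2) => a a' b b' b'0 b0 a'0 a0.
  have h (x y : R) : 0 <= x -> 0 <= y -> (1 + x) * (1 + y) <= 2 + x ^+ 2 + y ^+ 2.
    move=> x0 y0; have := sqr_ge0 (x - y); have := sqr_ge0 (x - 1); have := sqr_ge0 (y - 1); lra.
  apply: (@le_trans _ _ (((1 + a) * (1 + b)) * ((1 + a') * (1 + b')))).
    have -> : (1 + a) * (1 + b) * ((1 + a') * (1 + b')) = ((1 + a) * (1 + a')) * ((1 + b) * (1 + b')).
      by ring.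
    apply: ler_pM; rewrite ?addr_ge0//.
      by have := mulr_ge0 a0 a'0; lra.
    by have := mulr_ge0 b0 b'0; lra.
  by apply: ler_pM; rewrite ?mulr_ge0 ?addr_ge0 ?h.
have mpmu := integrable_moment_marg_prod kX_meas kY_meas mu_moment.
have mpmu' := integrable_moment_marg_prod kX_meas kY_meas mu'_moment.
rewrite double_cint_kernels.
rewrite (double_cint_resample mX mY rho_moment mu_moment mpmu mu'_moment mpmu').
apply: eq_integral => w' _; apply: eq_integral => w _; congr (_%:E).
by rewrite !mixed2E /second_difference !dX' !dY'; ring.
Qed.

End hs_dot_cross_covariances.

(** * The conditional cross-covariance operator *)

Lemma moment_class_integrable (R : realType) d (T : measurableType d)
    (m : {finite_measure set T -> \bar R}) (k : T -> T -> R) n :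
  measurable_kernel2 k -> (forall x, 0 <= k x x) ->
  moment_class n%:R k (charge_of_finite_measure m) ->
  m.-integrable [set: T] (fun x => (k x x ^+ n)%:E).
Proof.
move=> mk k0 kn.
have mf : measurable_fun [set: T] (fun x => (k x x ^+ n)%:E).
  by apply/measurable_EFinP/measurable_funX; apply: measurable_kernel2_comp.
apply/integrableP; split => //.
have -> : (\int[m]_x `|(k x x ^+ n)%:E| = \int[m]_x ((k x x) `^ n%:R)%:E)%E.
  by apply: eq_integral => x _; rewrite powR_mulrn// gee0_abs// lee_fin exprn_ge0.
apply: le_lt_trans (kn : _ < _)%E.
apply: ge0_integral_le_variation.
  under eq_fun do rewrite powR_mulrn//.
  exact: mf.
by move=> x; rewrite lee_fin powR_ge0.
Qed.

(** A product bound makes partial integrals integrable again. *)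
Lemma integrable_integral_dominated (R : realType) d d' (T : measurableType d)
    (T' : measurableType d') (m : probability T R) (m' : {measure set T' -> \bar R})
    (G : T' * T -> R) (D' : T' -> R) (D : T -> R) :
  measurable_fun [set: T' * T] G -> (forall p, `|G p| <= D' p.1 * D p.2) ->
  m.-integrable [set: T] (EFin \o D) -> m'.-integrable [set: T'] (EFin \o D') ->
  m'.-integrable [set: T'] (fun t' => \int[m]_t (G (t', t))%:E)%E.
Proof.
move=> mG GD iD iD'; have mEG : measurable_fun [set: T' * T] (EFin \o G) by exact/measurable_EFinP.
pose C := (\int[m]_t D t)%R.
apply: (le_integrable measurableT _ _ (integrableZl measurableT C iD')).
  exact: (@measurable_integral_param _ _ _ _ _ m _ mEG).
move=> t' _; have mGt : measurable_fun [set: T] (fun t => (G (t', t))%:E).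
  exact: (measurableT_comp mEG (measurable_pair1 t')).
apply: le_trans (le_abse_integral m measurableT mGt) _.
apply: (@le_trans _ _ (\int[m]_t ((D' t')%:E * (D t)%:E))%E).
  apply: ge0_le_integral => //.
  - exact: measurableT_comp.
  - by apply: emeasurable_funM => //; exact: (measurable_int _ iD).
  - by move=> t _; rewrite -EFinM abse_EFin lee_fin.
rewrite integralZl// integral_EFin_Rintegral// -!EFinM abse_EFin lee_fin mulrC.
exact: ler_norm.
Qed.

Lemma measurable_mixed2 (R : realType) dX dY (Xs : measurableType dX) (Ys : measurableType dY)
    (a : Xs -> Xs -> R) (b : Ys -> Ys -> R) :
  measurable_kernel2 a -> measurable_kernel2 b ->
  measurable_fun [set: ((Xs * Ys) * (Xs * Ys)) * ((Xs * Ys) * (Xs * Ys))]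
    (fun p => mixed2 a b p.1 p.2).
Proof.
move=> ma mb; under eq_fun do rewrite mixed2E.
apply: measurable_funM; first apply: measurable_funM => //.
  by apply: measurable_funD; [apply: measurable_funB; first apply: measurable_funB|];
    apply: measurable_kernel2_comp => //; do 2 apply: measurableT_comp => //; exact: measurableT_comp.
by apply: measurable_funD; [apply: measurable_funB; first apply: measurable_funB|];
    apply: measurable_kernel2_comp => //; do 2 apply: measurableT_comp => //; exact: measurableT_comp.
Qed.

Section joint_variable.
Context {R : realType} dO dX dY (Omega : measurableType dO)
  (Xs : measurableType dX) (Ys : measurableType dY) (P : probability Omega R)
  (X : {RV P >-> Xs}) (Y : {RV P >-> Ys}).

Definition joint (o : Omega) : Xs * Ys := (X o, Y o).

Let measurable_joint : measurable_fun [set: Omega] joint.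
Proof. exact: measurable_fun_pair. Qed.

HB.instance Definition _ := isMeasurableFun.Build _ _ _ _ joint measurable_joint.

End joint_variable.

Section conditional_cross_covariance_theory.
Context {R : realType} dO dX dY dZ (Omega : measurableType dO)
  (Xs : measurableType dX) (Ys : measurableType dY) (Zs : measurableType dZ)
  (P : probability Omega R)
  (X : {RV P >-> Xs}) (Y : {RV P >-> Ys}) (Z : {RV P >-> Zs})
  (kX : Xs -> Xs -> R) (kY : Ys -> Ys -> R) (kZ : Zs -> Zs -> R)
  (HX : rkhs kX) (HY : rkhs kY) (HXZ : rkhs (prod_kernel kX kZ)).
Hypothesis kX_meas : measurable_kernel2 kX.
Hypothesis kY_meas : measurable_kernel2 kY.
Hypothesis kZ_meas : measurable_kernel2 kZ.
Hypothesis kZ_ge0 : forall z, 0 <= kZ z z.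
Variable K : Zs -> pprobability (Xs * Ys)%type R.
Hypothesis mK : measurable_fun [set: Zs] K.
Hypothesis K_law : cond_law (joint X Y) Z K.
Hypothesis moment_int : P.-integrable [set: Omega] (fun o => (moment_bound kX kY (joint X Y o))%:E).
Hypothesis kZ_int : (distribution P Z).-integrable [set: Zs] (fun z => (kZ z z)%:E).

Let PZ : probability Zs R := distribution P Z.

Local Notation W := ((Xs * Ys) * (Xs * Ys))%type.

Definition resample_at (z : Zs) : pprobability W R := resample (K z).
Let mres : measurable_fun [set: Zs] resample_at := measurable_resample mK.
Let M : probability (Zs * W)%type R := semidirect mres PZ.

(** The conditional operator resamples X and Y but keeps z fixed. *)
Definition featXZ (q : Zs * W) : HXZ :=
  kernel_section HXZ (q.2.1.1, q.1) - kernel_section HXZ (q.2.2.1, q.1).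
Definition featYZ (q : Zs * W) : HY := featY HY q.2.
Definition featZ_bound (q : Zs * W) : R := kZ q.1 q.1 + feat_bound kX kY q.2.

Lemma hdot_featXZ_rkhs f q : hdot f (featXZ q) =
  rkhs_fun f (q.2.1.1, q.1) - rkhs_fun f (q.2.2.1, q.1).
Proof. by rewrite hdotBr !hdot_kernel_section. Qed.

Lemma hdot_featXZ q' q : hdot (featXZ q') (featXZ q) =
  kZ q'.1 q.1 * hdot (featX HX q'.2) (featX HX q.2).
Proof.
rewrite !hdotBl !hdotBr !hdot_kernel_sections /prod_kernel/=; ring.
Qed.

Lemma hdot_featZ q' q :
  hdot (featXZ q') (featXZ q) * hdot (featYZ q') (featYZ q) =
  kZ q.1 q'.1 * mixed2 kX kY q.2 q'.2.
Proof.
rewrite [hdot (featXZ q') _]hdotC [hdot (featYZ q') _]hdotC hdot_featXZ -mulrA.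
by congr (_ * _); rewrite -(hdot_feat HX HY) hdotC [X in _ * X]hdotC.
Qed.

Lemma measurable_featXZ f : measurable_fun [set: Zs * W] (fun q => hdot f (featXZ q)).
Proof.
under eq_fun do rewrite hdot_featXZ_rkhs.
have mf := measurable_rkhs_fun f (measurable_prod_kernel kX_meas kZ_meas).
apply: measurable_funB.
  apply: (measurableT_comp mf (g := fun q : Zs * W => (q.2.1.1, q.1))).
  by apply: measurable_fun_pair => //; do 2 apply: measurableT_comp => //.
apply: (measurableT_comp mf (g := fun q : Zs * W => (q.2.2.1, q.1))).
by apply: measurable_fun_pair => //; do 2 apply: measurableT_comp => //.
Qed.

Lemma measurable_featYZ g : measurable_fun [set: Zs * W] (fun q => hdot g (featYZ q)).
Proof. exact: (measurableT_comp (measurable_featY kY_meas g)). Qed.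

Lemma feat_bound_ge0 w : 0 <= feat_bound kX kY w.
Proof. by apply: le_trans (sqr_ge0 _) (feat_sqr_le HX HY w). Qed.

Lemma featZ_bound_ge0 q : 0 <= featZ_bound q.
Proof. by rewrite addr_ge0 ?feat_bound_ge0. Qed.

(** The norm of featXZ is sqrt(kZ(z, z)) times that of featX, whence one moment of
    kZ suffices against two moments of kX and kY. *)
Lemma featZ_le q : `|featXZ q| * `|featYZ q| <= featZ_bound q.
Proof.
rewrite -(@ler_sqr R) ?nnegrE ?mulr_ge0 ?featZ_bound_ge0// exprMn.
rewrite -[X in X * _]hdot_norm hdot_featXZ hdot_norm -mulrA -exprMn.
apply: (@le_trans _ _ (kZ q.1 q.1 * feat_bound kX kY q.2)).
  by rewrite ler_wpM2l// feat_sqr_le.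
rewrite /featZ_bound sqrrD.
have := mulr_ge0 (kZ_ge0 q.1) (feat_bound_ge0 q.2).
have := sqr_ge0 (kZ q.1 q.1); have := sqr_ge0 (feat_bound kX kY q.2); lra.
Qed.

(** The z at which the conditional law has the second moments of the joint law;
    almost all z are such. *)
Definition regular (z : Zs) := (K z).-integrable [set: _] (EFin \o moment_bound kX kY).

Lemma ae_regular : {ae PZ, forall z, regular z}.
Proof.
apply: (ae_integrable_kernel mK K_law (phi := fun q => moment_bound kX kY q.2)) => //.
exact: (measurableT_comp (measurable_moment kX_meas kY_meas)).
Qed.

Let mmomentE : measurable_fun [set: Zs * (Xs * Ys)] (fun q => (moment_bound kX kY q.2)%:E).
Proof. by apply/measurable_EFinP; exact: (measurableT_comp (measurable_moment kX_meas kY_meas)). Qed.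

Let moment_intK : (\int[PZ]_z \int[K z]_p `|(moment_bound kX kY p)%:E| < +oo)%E.
Proof.
apply: ((integrable_semidirectP mK PZ mmomentE).1 _).
exact: ((integrable_joint_law mK K_law mmomentE).2 moment_int).
Qed.

Lemma integrable_featZ_bound : M.-integrable [set: Zs * W] (EFin \o featZ_bound).
Proof.
have mm := measurable_moment kX_meas kY_meas.
have i0 : M.-integrable [set: Zs * W] (fun q => (kZ q.1 q.1)%:E).
  apply/(integrable_semidirectP mres PZ).
    by apply/measurable_EFinP; apply: measurable_kernel2_comp.
  have [_] := integrableP _ _ _ kZ_int; apply: le_lt_trans.
  rewrite le_eqVlt; apply/orP; left; apply/eqP; apply: eq_integral => z _.
  by rewrite /= integral_cst// [X in (_ * X)%E](_ : _ = 1%E) ?mule1//; exact: probability_setT.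
have i1 : M.-integrable [set: Zs * W] (fun q => (moment_bound kX kY q.2.1)%:E).
  apply/(integrable_semidirectP mres PZ).
    by apply/measurable_EFinP; apply: (measurableT_comp mm); exact: measurableT_comp.
  apply: le_lt_trans moment_intK.
  rewrite le_eqVlt; apply/orP; left; apply/eqP; apply: eq_integral => z _.
  rewrite (ge0_integral_image_law measurable_fst (@resample_fst _ _ _ _ _ (K z)) (f := fun p => `|(moment_bound kX kY p)%:E|%E))//.
  by apply: measurableT_comp => //; exact/measurable_EFinP.
have i2 : M.-integrable [set: Zs * W] (fun q => (moment_bound kX kY q.2.2)%:E).
  apply/(integrable_semidirectP mres PZ).
    by apply/measurable_EFinP; apply: (measurableT_comp mm); exact: measurableT_comp.
  apply: le_lt_trans moment_intK.
  rewrite le_eqVlt; apply/orP; left; apply/eqP; apply: eq_integral => z _.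
  rewrite (ge0_integral_image_law measurable_snd (@resample_snd _ _ _ _ _ (K z)) (f := fun p => `|(moment_bound kX kY p)%:E|%E))//.
  by apply: measurableT_comp => //; exact/measurable_EFinP.
exact: (integrableD measurableT i0 (integrableD measurableT i1 i2)).
Qed.

Let norm_sectionXZ x z : `|kernel_section HXZ (x, z)| = Num.sqrt (kZ z z) * `|kernel_section HX x|.
Proof.
apply/eqP; rewrite -(@eqrXn2 _ 2) ?mulr_ge0 ?sqrtr_ge0// exprMn sqr_sqrtr//.
by rewrite !norm_kernel_section /prod_kernel/= mulrC.
Qed.

Let rkhsXZ_le (f : HXZ) z x :
  `|rkhs_fun f (x, z)| <= (`|f| * Num.sqrt (kZ z z)) * `|kernel_section HX x|.
Proof. by rewrite -mulrA -norm_sectionXZ norm_rkhs_fun_le. Qed.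

Let moment_sections_le (z : Zs) (p : Xs * Ys) :
  Num.sqrt (kZ z z) * (`|kernel_section HX p.1| * `|kernel_section HY p.2|) <=
  kZ z z + moment_bound kX kY p /\
  Num.sqrt (kZ z z) * `|kernel_section HX p.1| <= kZ z z + moment_bound kX kY p.
Proof.
rewrite (momentE HX HY) -{2 4}(sqr_sqrtr (kZ_ge0 z)).
move: (Num.sqrt _) `|kernel_section HX p.1| `|kernel_section HY p.2| => a t s.
have := sqr_ge0 (a - t); have := sqr_ge0 (a - t * s).
have := sqr_ge0 (t ^+ 2 - s ^+ 2); have := sqr_ge0 (t ^+ 2 - 1).
have := sqr_ge0 (t ^+ 2); have := sqr_ge0 (s ^+ 2); have := sqr_ge0 a.
by split; lra.
Qed.

Let dominated_int (phi : Zs * (Xs * Ys) -> R) C :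
  measurable_fun [set: _] phi ->
  (forall z p, `|phi (z, p)| <= C * (kZ z z + moment_bound kX kY p)) ->
  P.-integrable [set: Omega] (fun o => (phi (Z o, joint X Y o))%:E).
Proof.
move=> mphi phiC.
have mEphi : measurable_fun [set: Zs * (Xs * Ys)] (EFin \o phi) by exact/measurable_EFinP.
have iZ : P.-integrable [set: Omega] (fun o => (kZ (Z o) (Z o))%:E).
  have mkZ : measurable_fun [set: Zs] (fun z => (kZ z z)%:E).
    by apply/measurable_EFinP; apply: measurable_kernel2_comp.
  have lawZ A : measurable A -> P (Z @^-1` A) = PZ A by [].
  have mZ : measurable_fun [set: Omega] Z by exact: measurable_funP.
  exact: ((integrable_image_law mZ lawZ mkZ).1 kZ_int).
have iB := integrableZl measurableT C (integrableD measurableT iZ moment_int).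
apply: (le_integrable measurableT _ _ iB).
  apply: (measurableT_comp mEphi (g := fun o => (Z o, joint X Y o))).
  exact: measurable_fun_pair.
move=> o _; rewrite -EFinD -EFinM !abse_EFin lee_fin.
by apply: le_trans (phiC _ _) _; exact: ler_norm.
Qed.

(** The products of conditional expectations and the expectations of products are
    integrals over z; at each regular z their difference is a covariance under K z,
    which the resampling formula computes. *)
Lemma cond_cross_cov_feature_op (Sigma : HXZ -> HY) : is_cond_cross_cov X Y Z Sigma ->
  feature_op featXZ featYZ M Sigma.
Proof.
move=> SigmaE f g.
have mfXZ := measurable_rkhs_fun f (measurable_prod_kernel kX_meas kZ_meas).
have mg := measurable_rkhs_fun g kY_meas.
pose phi (q : Zs * (Xs * Ys)) := rkhs_fun f (q.2.1, q.1).
pose psi (q : Zs * (Xs * Ys)) := rkhs_fun g q.2.2.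
have mphi : measurable_fun [set: _] phi.
  apply: (measurableT_comp mfXZ (g := fun q : Zs * (Xs * Ys) => (q.2.1, q.1))).
  by apply: measurable_fun_pair => //; exact: measurableT_comp.
have mpsi : measurable_fun [set: _] psi.
  by apply: (measurableT_comp mg); exact: measurableT_comp.
have iphi : P.-integrable [set: Omega] (fun o => (phi (Z o, joint X Y o))%:E).
  apply: (dominated_int (C := `|f|)) => // z p; apply: le_trans (rkhsXZ_le _ _ _) _.
  by rewrite -mulrA ler_wpM2l//; exact: (moment_sections_le z p).2.
have ipsi : P.-integrable [set: Omega] (fun o => (psi (Z o, joint X Y o))%:E).
  apply: (dominated_int (C := `|g|)) => // z p; apply: le_trans (norm_rkhs_fun_le _ _) _.
  rewrite ler_wpM2l//; apply: (@le_trans _ _ (moment_bound kX kY p)); last by rewrite lerDr.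
  by rewrite (momentE HX HY) addrAC; exact: le_add1_pow4.
have mpp : measurable_fun [set: _] (fun q => phi q * psi q) by exact: measurable_funM.
have ipp : P.-integrable [set: Omega] (fun o => (phi (Z o, joint X Y o) * psi (Z o, joint X Y o))%:E).
  apply: (dominated_int (phi := fun q => phi q * psi q) (C := `|f| * `|g|)) => // z p.
  rewrite normrM; apply: le_trans (ler_pM _ _ (rkhsXZ_le f z p.1) (norm_rkhs_fun_le g p.2)) _ => //.
  rewrite [leLHS](_ : _ = `|f| * `|g| * (Num.sqrt (kZ z z) *
    (`|kernel_section HX p.1| * `|kernel_section HY p.2|))); last by ring.
  by rewrite ler_wpM2l ?mulr_ge0//; exact: (moment_sections_le z p).1.
have cphi := cond_expectation_kernel_mean mK K_law mphi iphi.
have cpsi := cond_expectation_kernel_mean mK K_law mpsi ipsi.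
rewrite (SigmaE f g _ _ cphi cpsi).
pose A z : \bar R := (\int[K z]_p (phi (z, p) * psi (z, p))%:E)%E.
pose B z : \bar R := (\int[resample_at z]_w (hdot f (featXZ (z, w)) * hdot g (featYZ (z, w)))%:E)%E.
have mEpp : measurable_fun [set: _] (fun q => (phi q * psi q)%:E) by exact/measurable_EFinP.
have iA' : (semidirect mK PZ).-integrable [set: _] (fun q => (phi q * psi q)%:E).
  exact: ((integrable_joint_law mK K_law mEpp).2 ipp).
have iA : PZ.-integrable [set: Zs] A by exact: (integrable_integral_semidirect iA').
have iB' : M.-integrable [set: _] (fun q => (hdot f (featXZ q) * hdot g (featYZ q))%:E).
  by apply: (feature_integrable measurable_featXZ measurable_featYZ featZ_le); exact: integrable_featZ_bound.
have iB : PZ.-integrable [set: Zs] B by exact: (integrable_integral_semidirect iB').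
have -> : ('E_P[fun o => (rkhs_fun f (X o, Z o) * rkhs_fun g (Y o))%R] = \int[PZ]_z A z)%E.
  rewrite unlock -(integral_semidirect iA').
  by rewrite (integral_joint_law mK K_law mEpp).
have -> : ('E_PZ[fun z => (kernel_mean K phi z * kernel_mean K psi z)%R] =
    \int[PZ]_z (A z - B z))%E.
  rewrite unlock; apply: (eq_integral_null ae_regular) => z /contrapT zreg.
  have mfz : measurable_fun [set: Xs] (fun x => rkhs_fun f (x, z)).
    exact: (measurableT_comp mfXZ (measurable_pair2 z)).
  have C0 : 0 <= `|f| * Num.sqrt (kZ z z) by rewrite mulr_ge0 ?sqrtr_ge0.
  have := integral_feat_covariance kY_meas zreg g C0 mfz (rkhsXZ_le f z).
  have iz := integrable_mul_rkhs kY_meas zreg g C0 mfz (rkhsXZ_le f z).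
  have Afin : A z \is a fin_num by exact: integrable_fin_num iz.
  have BE : B z = (\int[resample (K z)]_w ((rkhs_fun f (w.1.1, z) -
      rkhs_fun f (w.2.1, z)) * hdot g (featY HY w))%:E)%E.
    by apply: eq_integral => w _; rewrite hdot_featXZ_rkhs.
  rewrite -BE -/(A z) => ->.
  by rewrite -(fineK Afin) -!EFinB opprB addrC subrK.
have -> : (\int[M]_w (hdot f (featXZ w) * hdot g (featYZ w))%:E = \int[PZ]_z B z)%E.
  exact: (integral_semidirect iB').
have -> : (\int[PZ]_z (A z - B z) = \int[PZ]_z A z - \int[PZ]_z B z)%E.
  exact: (integralB measurableT iA iB).
have Af := integrable_fin_num measurableT iA; have Bf := integrable_fin_num measurableT iB.
rewrite -(fineK Af) -(fineK Bf) -!EFinB.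
by congr (_%:E); lra.
Qed.

Let kernel_average z z' : \bar R := (\int[resample_at z']_w' \int[resample_at z]_w (mixed2 kX kY w w')%:E)%E.

(** The Hilbert-Schmidt norm is a double integral over (z, w) and (z', w').
    Disintegrating both and exchanging z with w' puts the two z-integrals outside;
    kZ(z, z') then leaves the inner integrals. *)
Theorem hs_norm_cond_cross_cov (E : set HXZ) (Sigma : {linear HXZ -> HY}) :
  orthonormal_basis E -> bounded_op Sigma -> is_cond_cross_cov X Y Z Sigma ->
  (hs_norm E Sigma ^+ 2 =
   \int[PZ]_z' \int[PZ]_z ((kZ z z')%:E * kernel_average z z'))%E.
Proof.
move=> E_onb Sb /cond_cross_cov_feature_op SF.
have iD := integrable_featZ_bound.
rewrite hs_norm_sqr (hs_dot_feature_op measurable_featXZ measurable_featYZ featZ_le E_onb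
  iD iD Sb Sb SF SF).
pose G (p : (Zs * W) * (Zs * W)) : R := kZ p.2.1 p.1.1 * mixed2 kX kY p.2.2 p.1.2.
have G_le p : `|G p| <= featZ_bound p.1 * featZ_bound p.2.
  rewrite /G -hdot_featZ.
  apply: le_trans (feature_le featZ_le _ _ _) _.
  by rewrite ler_wpM2r ?featZ_bound_ge0// featZ_le.
have mm2 := measurable_mixed2 kX_meas kY_meas.
have mG : measurable_fun [set: (Zs * W) * (Zs * W)] G.
  apply: measurable_funM.
    by apply: measurable_kernel2_comp => //; exact: measurableT_comp.
  apply: (measurableT_comp mm2 (g := fun p : (Zs * W) * (Zs * W) => (p.2.2, p.1.2))).
  by apply: measurable_fun_pair; exact: measurableT_comp.
have mEG : measurable_fun [set: (Zs * W) * (Zs * W)] (EFin \o G) by exact/measurable_EFinP.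
have intG q' : M.-integrable [set: _] (fun q => (G (q', q))%:E).
  apply: (le_integrable measurableT _ _ (integrableZl measurableT (featZ_bound q') iD)).
    exact: (measurableT_comp mEG (measurable_pair1 q')).
  move=> q _; rewrite -EFinM !abse_EFin lee_fin.
  by apply: le_trans (G_le _) _; exact: ler_norm.
have iPhi := integrable_integral_dominated mG G_le iD iD.
transitivity (\int[M]_q' \int[M]_q (G (q', q))%:E)%E.
  by apply: eq_integral => q' _; apply: eq_integral => q _; rewrite hdot_featZ.
rewrite (integral_semidirect iPhi); apply: (eq_integral_null ae_regular) => z' /contrapT reg'.
have ifb' := integrable_feat_bound kX_meas kY_meas reg'.
(* w is integrated out first, so that only w' and z have to be exchanged *)
pose Gam (p : W * Zs) : \bar R := (\int[resample_at p.2]_w (G ((z', p.1), (p.2, w)))%:E)%E.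
transitivity (\int[resample_at z']_w' \int[PZ]_z Gam (w', z))%E.
  by apply: eq_integral => w' _; rewrite (integral_semidirect (intG (z', w'))).
have mGam : measurable_fun [set: W * Zs] Gam.
  have mres2 : measurable_fun [set: (W * Zs)%type] (resample_at \o snd) by exact: measurableT_comp.
  apply: (measurable_integral_pprobability mres2 (f := fun x => (G ((z', x.1.1), (x.1.2, x.2)))%:E)).
  apply: (measurableT_comp mEG (g := fun x : (W * Zs) * W => ((z', x.1.1), (x.1.2, x.2)))).
  by apply: measurable_fun_pair; apply: measurable_fun_pair => //; exact: measurableT_comp.
have iGam : (resample_at z' \x PZ)%E.-integrable [set: W * Zs] Gam.
  apply/integrable12ltyP => //.
  have iD' : (resample_at z').-integrable [set: W] (fun w' => (featZ_bound (z', w'))%:E).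
    have ic : (resample_at z').-integrable [set: W] (EFin \o cst (kZ z' z')).
      exact: finite_measure_integrable_cst.
    exact: (integrableD measurableT ic ifb').
  pose C := (\int[M]_q (featZ_bound q)%:E)%E.
  have Cfin : C \is a fin_num by exact: integrable_fin_num.
  apply: (@le_lt_trans _ _ (\int[resample_at z']_w' ((fine C)%:E * (featZ_bound (z', w'))%:E))%E); last first.
    by apply: integrable_lty => //; exact: integrableZl.
  apply: ge0_le_integral => //.
  - by move=> w' _; exact: integral_ge0.
  - apply: (@measurable_integral_param _ _ _ _ _ PZ (abse \o Gam)); exact: measurableT_comp.
  - by apply: emeasurable_funM => //; exact: (measurable_int _ iD').
  - move=> w' _; have mGw : measurable_fun [set: _] (fun q => (G ((z', w'), q))%:E).
      exact: (measurableT_comp mEG (measurable_pair1 (z', w'))).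
    have mGz z : measurable_fun [set: W] (fun w => (G ((z', w'), (z, w)))%:E).
      exact: (measurableT_comp mGw (measurable_pair1 z)).
    apply: (@le_trans _ _ (\int[PZ]_z \int[resample_at z]_w `|(G ((z', w'), (z, w)))%:E|)%E).
      apply: ge0_le_integral => //.
      + by apply: measurableT_comp => //; exact: (measurableT_comp mGam (measurable_pair1 w')).
      + apply: (measurable_integral_pprobability mres (f := fun q => `|(G ((z', w'), q))%:E|%E)).
        exact: measurableT_comp.
      + by move=> z _; apply: le_abse_integral => //; exact: mGz.
    rewrite -(ge0_integral_semidirect mres PZ (f := fun q => `|(G ((z', w'), q))%:E|%E))//; last first.
      exact: measurableT_comp.
    rewrite (fineK Cfin) muleC -integralZl//; apply: ge0_le_integral => //.
    + exact: measurableT_comp.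
    + by apply: emeasurable_funM => //; exact: (measurable_int _ iD).
    + by move=> q _; rewrite -EFinM abse_EFin lee_fin; exact: (G_le ((z', w'), q)).
rewrite (Fubini iGam).
apply: (eq_integral_null ae_regular) => z /contrapT reg.
have ifb := integrable_feat_bound kX_meas kY_meas reg.
pose m2 (p : W * W) : R := mixed2 kX kY p.2 p.1.
have m2_le p : `|m2 p| <= feat_bound kX kY p.1 * feat_bound kX kY p.2.
  rewrite /m2 -(hdot_feat HX HY); apply: le_trans (feature_le (feat_le HX HY) _ _ _) _.
  by rewrite ler_wpM2r ?feat_bound_ge0// feat_le.
have mm2' : measurable_fun [set: W * W] m2.
  apply: (measurableT_comp mm2 (g := fun p : W * W => (p.2, p.1))).
  exact: measurable_fun_pair.
have iI := integrable_integral_dominated mm2' m2_le ifb ifb'.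
rewrite /kernel_average -(integralZl measurableT iI).
apply: eq_integral => w' _; rewrite -integralZl//.
apply: (le_integrable measurableT _ _ (integrableZl measurableT (feat_bound kX kY w') ifb)).
  by apply/measurable_EFinP; exact: (measurableT_comp mm2' (measurable_pair1 w')).
move=> w _; rewrite -EFinM !abse_EFin lee_fin.
by apply: le_trans (m2_le (w', w)) _; exact: ler_norm.
Qed.

End conditional_cross_covariance_theory.

(** * The squared norm as an average over pairs of conditioning values *)

Local Open Scope ereal_scope.
Theorem theorem2 (R : realType) (dO dX dY dZ : measure_display)
  (Omega : measurableType dO) (Xs : measurableType dX)
  (Ys : measurableType dY) (Zs : measurableType dZ)
  (P : probability Omega R)
  (X : {RV P >-> Xs}) (Y : {RV P >-> Ys}) (Z : {RV P >-> Zs})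
  (kX : Xs -> Xs -> R) (kY : Ys -> Ys -> R) (kZ : Zs -> Zs -> R)
  (kX_pd : posdef_kernel kX) (kY_pd : posdef_kernel kY)
  (kZ_pd : posdef_kernel kZ)
  (kX_meas : measurable_kernel2 kX) (kY_meas : measurable_kernel2 kY)
  (kZ_meas : measurable_kernel2 kZ)
  (PX_moment :
    moment_class 2 kX (charge_of_finite_measure (distribution P X)))
  (PY_moment :
    moment_class 2 kY (charge_of_finite_measure (distribution P Y)))
  (PZ_moment :
    moment_class 1 kZ (charge_of_finite_measure (distribution P Z)))
  (K : Zs -> pprobability (Xs * Ys)%type R)
  (K_law : cond_law (fun o => (X o, Y o)) Z K)
  (HX : rkhs kX) (HY : rkhs kY) (HXZ : rkhs (prod_kernel kX kZ))
  (EX : set HX) (EX_onb : orthonormal_basis EX)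
  (EXZ : set HXZ) (EXZ_onb : orthonormal_basis EXZ)
  (dotSigma : Zs -> {linear HX -> HY})
  (dotSigma_bounded :
    {ae distribution P Z, forall z, bounded_op (dotSigma z)})
  (dotSigmaE :
    {ae distribution P Z, forall z, is_cross_cov (K z) (dotSigma z)})
  (Sigma : {linear HXZ -> HY})
  (Sigma_bounded : bounded_op Sigma)
  (SigmaE : is_cond_cross_cov X Y Z Sigma) :
  let PZ := distribution P Z in
  let v z := dependence_charge (K z) in
  let h z z' := double_cint kX kY (v z) (v z') in
  [/\ hs_norm EXZ Sigma ^+ 2 =
        \int[PZ]_z' \int[PZ]_z
          ((kZ z z')%:E * hs_dot EX (dotSigma z) (dotSigma z')),
      \int[PZ]_z' \int[PZ]_z
          ((kZ z z')%:E * hs_dot EX (dotSigma z) (dotSigma z')) =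
        \int[PZ]_z' \int[PZ]_z ((kZ z z')%:E * h z z') &
      forall (rhoX : Xs -> Xs -> R) (rhoY : Ys -> Ys -> R)
        (theta : Xs) (theta' : Ys),
        semimetric rhoX -> semimetric rhoY ->
        distance_induced rhoX theta kX -> distance_induced rhoY theta' kY ->
        exists2 N : set Zs, PZ.-negligible N &
          forall z z', ~ N z -> ~ N z' ->
            h z z' = double_cint rhoX rhoY (v z) (v z')].
Proof.
move=> PZ v h.
have mK := K_law.1.
have K_law' : cond_law (joint X Y) Z K by exact: K_law.
have kZ_ge0 z : (0 <= kZ z z)%R.
  by have := kZ_pd.2 1%N (fun=> 1%R) (fun=> z); rewrite !big_ord1 !mul1r.
have iX := moment_class_integrable kX_meas (rkhs_kernel_ge0 HX) PX_moment.
have iY := moment_class_integrable kY_meas (rkhs_kernel_ge0 HY) PY_moment.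
have iZ : PZ.-integrable [set: Zs] (fun z => (kZ z z)%:E).
  exact: (moment_class_integrable (n := 1) kZ_meas kZ_ge0 PZ_moment).
have moment_int : P.-integrable [set: Omega] (fun o => (moment_bound kX kY (joint X Y o))%:E).
  have lawX A : measurable A -> P (X @^-1` A) = distribution P X A by [].
  have lawY A : measurable A -> P (Y @^-1` A) = distribution P Y A by [].
  have mX : measurable_fun [set: Omega] X by exact: measurable_funP.
  have mY : measurable_fun [set: Omega] Y by exact: measurable_funP.
  have iXo := (integrable_image_law mX lawX (measurable_int _ iX)).1 iX.
  have iYo := (integrable_image_law mY lawY (measurable_int _ iY)).1 iY.
  have i2 : P.-integrable [set: Omega] (EFin \o cst 2%R).
    exact: finite_measure_integrable_cst.
  exact: (integrableD measurableT (integrableD measurableT i2 iXo) iYo).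
have reg := ae_regular kX_meas kY_meas mK K_law' moment_int.
pose good z := [/\ bounded_op (dotSigma z), is_cross_cov (K z) (dotSigma z) & regular kX kY K z].
have good_ae : PZ.-negligible (~` [set z | good z]).
  have : {ae PZ, forall z, good z}.
    apply: filterS3 dotSigma_bounded dotSigmaE reg => z; by split.
  by [].
have h_good z z' : good z -> good z' -> h z z' =
    \int[resample (K z')]_w' \int[resample (K z)]_w (mixed2 kX kY w w')%:E.
  by move=> [_ _ gz] [_ _ gz']; exact: (double_cint_kernels HX HY kX_meas kY_meas gz gz').
have hs_good z z' : good z -> good z' -> hs_dot EX (dotSigma z) (dotSigma z') = h z z'.
  move=> [bz cz gz] [bz' cz' gz'].
  exact: (hs_dot_cross_cov kX_meas kY_meas gz gz' EX_onb bz bz' cz cz').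
have hs_h : \int[PZ]_z' \int[PZ]_z ((kZ z z')%:E * hs_dot EX (dotSigma z) (dotSigma z')) =
        \int[PZ]_z' \int[PZ]_z ((kZ z z')%:E * h z z').
  apply: (eq_integral_null good_ae) => z' /contrapT gz'.
  by apply: (eq_integral_null good_ae) => z /contrapT gz; rewrite hs_good.
split; [|exact: hs_h|].
- rewrite hs_h (hs_norm_cond_cross_cov HX kX_meas kY_meas kZ_meas kZ_ge0 mK K_law' moment_int iZ EXZ_onb Sigma_bounded SigmaE).
  apply: (eq_integral_null good_ae) => z' /contrapT gz'.
  by apply: (eq_integral_null good_ae) => z /contrapT gz; rewrite h_good.
- move=> rhoX rhoY theta theta' smX smY dX' dY'.
  exists (~` [set z | regular kX kY K z]); first exact: reg.
  move=> z z' /contrapT gz /contrapT gz'.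
  exact: (double_cint_distance HX HY kX_meas kY_meas gz gz' smX smY dX' dY').
Qed.
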